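(* Let $\sigma$ be a highly computable implicit signature containing a non-explicit operation, and let $\mathsf{H}$ be a recursively enumerable pseudovariety of groups that is $\sigma$-reducible for finite systems of pointlike equations. Then the pseudovariety $\mathsf{DRH}$ is also $\sigma$-reducible for finite systems of pointlike equations.
   Context: $\mathsf{S}$ is the pseudovariety of all finite semigroups. For a pseudovariety of groups $\mathsf{H}$, $\mathsf{DRH}$ is the pseudovariety of all finite semigroups whose regular $\mathcal{R}$-classes are groups belonging to $\mathsf{H}$. For a pseudovariety $\mathsf{V}$ and a finite set $A$, $\overline{\Omega}_A\mathsf{V}$ is the free pro-$\mathsf{V}$ semigroup on $A$ and $\rho_{\mathsf{V}}:\overline{\Omega}_A\mathsf{S}\to\overline{\Omega}_A\mathsf{V}$ is the canonical projection; elements of $\overline{\Omega}_A\mathsf{S}$ are called pseudowords. $T^I$ denotes the semigroup $T$ with a new identity $I$ adjoined (for $T=\overline{\Omega}_A\mathsf{S}$, $I$ is called the empty word and is an isolated point). For $u,v\in(\overline{\Omega}_A\mathsf{S})^I$, $u=_{\mathsf{V}}v$ means $\rho_{\mathsf{V}}(u)=\rho_{\mathsf{V}}(v)$, where $\rho_{\mathsf{DRH}}(I)=I$ and, for a pseudovariety of groups $\mathsf{H}$, $\rho_{\mathsf{H}}(I)=1$ is the identity element of $\overline{\Omega}_A\mathsf{H}$. Pseudowords are identified with implicit operations (which act on every profinite semigroup); those given by elements of free semigroups $A^+$ are called explicit. An implicit signature $\sigma$ is a set of implicit operations (containing multiplication). It is highly computable if it is a recursively enumerable set and all its elements are computable operations.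 $\Omega^{\sigma}_A\mathsf{S}$ is the $\sigma$-subalgebra of $\overline{\Omega}_A\mathsf{S}$ generated by $A$; its elements are called $\sigma$-words. A finite system of equations in a finite set of variables $X$ comes with a constraint for each $x\in X$, namely a clopen subset $K_x\subseteq(\overline{\Omega}_A\mathsf{S})^I$ for a finite alphabet $A$. A solution modulo $\mathsf{V}$ of a system $\{u_i=v_i\}_i$ (with $u_i,v_i\in\overline{\Omega}_X\mathsf{S}$) is a continuous homomorphism $\delta:\overline{\Omega}_X\mathsf{S}\to(\overline{\Omega}_A\mathsf{S})^I$ with $\delta(u_i)=_{\mathsf{V}}\delta(v_i)$ for all $i$ and $\delta(x)\in K_x$ for all $x\in X$. It is a solution in $\sigma$-words if $\delta(X)\subseteq(\Omega^{\sigma}_A\mathsf{S})^I$. For a class $\mathcal{C}$ of finite systems, $\mathsf{V}$ is $\sigma$-reducible for $\mathcal{C}$ if, for every system in $\mathcal{C}$ and every choice of clopen constraints, the existence of a solution modulo $\mathsf{V}$ implies the existence of a solution modulo $\mathsf{V}$ in $\sigma$-words. A finite system of pointlike equations is a system of the form $\{x_{k,1}=\cdots=x_{k,n_k}\}_{k=1}^N$ where the $x_{k,j}$ are variables. *)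

(* Defs.v *)
From Stdlib Require Cantor.
From HB Require Import structures.
From mathcomp Require Import all_boot all_classical.
From mathcomp Require Import topology.

Set Implicit Arguments.
Unset Strict Implicit.
Unset Printing Implicit Defensive.

Local Open Scope classical_set_scope.
Local Open Scope group_scope.

(* Every nonempty finite semigroup is isomorphic to one with carrier
   {0, ..., n}; finite semigroups are represented by such multiplication
   tables, which keeps them in a small type.  Classes of finite semigroups are
   sets of tables, and pseudovarieties (below) are closed under isomorphism. *)
Record finSemigroup := FinSemigroup {
  fsg_pred : nat;
  fsg_mul : 'I_fsg_pred.+1 -> 'I_fsg_pred.+1 -> 'I_fsg_pred.+1;
  fsg_mulA : associative fsg_mul }.

(* An alias, so that the additive structure of ['I_n.+1] is not found first. *)
Definition fsg_sort (S : finSemigroup) : Type := 'I_(fsg_pred S).+1.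
Coercion fsg_sort : finSemigroup >-> Sortclass.

HB.instance Definition _ (S : finSemigroup) := Finite.on (fsg_sort S).
HB.instance Definition _ (S : finSemigroup) :=
  isSemigroup.Build (fsg_sort S) (@fsg_mulA S).

Definition is_one (T : magmaType) (e : T) := forall x : T, e * x = x /\ x * e = x.

Definition is_group (T : magmaType) :=
  exists2 e : T, is_one e & forall x : T, exists y : T, x * y = e /\ y * x = e.

(* [pv_prod] covers binary products; the empty product is the trivial
   semigroup, a quotient of any member. *)
Record pseudovariety (V : set finSemigroup) : Prop := Pseudovariety {
  pv_nonempty : V !=set0;
  pv_sub : forall (S T : finSemigroup) (h : {multiplicative S -> T}),
    injective h -> V T -> V S;
  pv_quotient : forall (S T : finSemigroup) (h : {multiplicative S -> T}),
    (forall y, exists x, h x = y) -> V S -> V T;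
  pv_prod : forall (S T P : finSemigroup)
    (h : {multiplicative P -> (S * T)%type}),
    bijective h -> V S -> V T -> V P }.

Definition all_groups (V : set finSemigroup) :=
  forall S : finSemigroup, V S -> is_group S.

Definition pseudovariety_of_groups (V : set finSemigroup) :=
  pseudovariety V /\ all_groups V.

Definition pvS : set finSemigroup := setT.

Definition right_ideal1 (T : magmaType) (a b : T) := b = a \/ exists x, b = a * x.

Definition greenR (T : magmaType) (a b : T) :=
  right_ideal1 a b /\ right_ideal1 b a.

Definition regular (T : magmaType) (a : T) := exists x, a * x * a = a.

(* Members of V are tables: the subset [X] belongs to V when it is the image of
   an embedding of one of them. *)
Definition subset_in (V : set finSemigroup) (S : finSemigroup) (X : set S) :=
  exists2 G : finSemigroup, V G &
  exists2 f : {multiplicative G -> S}, injective f & range f = X.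

(* The regular R-classes are exactly the R-classes of the regular elements. *)
Definition DRH (H : set finSemigroup) : set finSemigroup :=
  [set S : finSemigroup | forall a : S, regular a -> subset_in H [set b | greenR a b]].

(* The free pro-V semigroup on [A], as the semigroup of [A]-ary implicit
   operations on V: families of maps [S^A -> S], for S in V, that commute with
   all homomorphisms between members of V.  The product is pointwise, and the
   topology is that of the product of the finite discrete spaces S, indexed by
   the pairs formed of a member S of V and a map [A -> S]. *)
Record free_pro (V : set finSemigroup) (A : finType) := FreePro {
  op_at : forall S : {S : finSemigroup | V S}, (A -> sval S) -> sval S;
  op_natural : forall (S T : {S : finSemigroup | V S})
    (h : {multiplicative sval S -> sval T}) (s : A -> sval S),
    op_at (S := T) (h \o s) = h (op_at s) }.

Definition eval_all (V : set finSemigroup) (A : finType) (u : free_pro V A) :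
  prod_topology (fun i : {S : {S : finSemigroup | V S} & A -> sval S} =>
                   discrete_topology (sval (tag i))) :=
  fun i => op_at u (tagged i).

Lemma free_pro_eq (V : set finSemigroup) (A : finType) (u v : free_pro V A) :
  (forall (S : {S : finSemigroup | V S}) (s : A -> sval S), op_at u s = op_at v s) -> u = v.
Proof.
case: u v => [u nu] [v nv] /= uv.
have e : u = v by apply: functional_extensionality_dep => S; apply/funext => s.
by rewrite {}e in nu uv *; congr FreePro; apply: Prop_irrelevance.
Qed.

HB.instance Definition _ (V : set finSemigroup) (A : finType) :=
  gen_eqMixin (free_pro V A).
HB.instance Definition _ (V : set finSemigroup) (A : finType) :=
  gen_choiceMixin (free_pro V A).
HB.instance Definition _ (V : set finSemigroup) (A : finType) :=
  Topological.copy (free_pro V A) (initial_topology (@eval_all V A)).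

Section FreeProSemigroup.
Variables (V : set finSemigroup) (A : finType).

Fact free_pro_mul_natural (u v : free_pro V A) (S T : {S : finSemigroup | V S})
    (h : {multiplicative sval S -> sval T}) (s : A -> sval S) :
  op_at u (h \o s) * op_at v (h \o s) = h (op_at u s * op_at v s).
Proof. by rewrite !op_natural gmulfM. Qed.

Definition free_pro_mul (u v : free_pro V A) : free_pro V A :=
  FreePro (free_pro_mul_natural u v).

Fact free_pro_mulA : associative free_pro_mul.
Proof. by move=> u v w; apply: free_pro_eq => S s /=; rewrite mulgA. Qed.

HB.instance Definition _ := isSemigroup.Build (free_pro V A) free_pro_mulA.

Definition gen (a : A) : free_pro V A :=
  @FreePro V A (fun S s => s a) (fun S T h s => erefl).

End FreeProSemigroup.

Arguments gen {V A}.

Section FreeProOne.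
Variables (V : set finSemigroup) (gV : all_groups V) (A : finType).

Definition group_one (S : {S : finSemigroup | V S}) : sval S :=
  sval (cid2 (gV (svalP S))).

Fact group_oneP (S : {S : finSemigroup | V S}) : is_one (group_one S).
Proof. by rewrite /group_one; case: cid2. Qed.

Fact group_one_natural (S T : {S : finSemigroup | V S})
    (h : {multiplicative sval S -> sval T}) (s : A -> sval S) :
  group_one T = h (group_one S).
Proof.
case: (gV (svalP T)) => e e1 einv.
have hh : h (group_one S) * h (group_one S) = h (group_one S).
  by rewrite -gmulfM (group_oneP _).1.
have [y [hy _]] := einv (h (group_one S)).
rewrite -[h _ in RHS](e1 _).2 -hy mulgA hh hy.
by rewrite -[LHS](e1 _).2 (group_oneP _).1.
Qed.

Definition free_pro_one : free_pro V A :=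
  @FreePro V A (fun S _ => group_one S) group_one_natural.

Fact free_pro_oneP : is_one free_pro_one.
Proof. by move=> u; split; apply: free_pro_eq => S s /=; case: (group_oneP (op_at u s)). Qed.

End FreeProOne.

Notation pseudoword := (free_pro pvS).

Definition in_pvS (S : finSemigroup) : {S : finSemigroup | pvS S} := exist _ S I.

Section Projection.
Variables (V : set finSemigroup) (A : finType) (u : pseudoword A).

Definition rho_at (S : {S : finSemigroup | V S}) (s : A -> sval S) : sval S :=
  op_at (S := in_pvS (sval S)) u s.

Fact rho_natural (S T : {S : finSemigroup | V S})
    (h : {multiplicative sval S -> sval T}) (s : A -> sval S) :
  rho_at (S := T) (h \o s) = h (rho_at s).
Proof. exact: (@op_natural _ _ u (in_pvS (sval S)) (in_pvS (sval T)) h s). Qed.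

Definition rho : free_pro V A := FreePro rho_natural.

End Projection.

Arguments rho V {A} u.

Definition adj_one (T : Type) : Type := option T.

Notation "T '^I'" := (adj_one T) (at level 2, format "T '^I'") : type_scope.

HB.instance Definition _ (T : choiceType) := Choice.on (T^I).

Section AdjoinOneMonoid.
Variable T : semigroupType.

Definition adj_mul (u v : T^I) : T^I :=
  match u, v with
  | Some x, Some y => Some (x * y)
  | Some x, None => Some x
  | None, _ => v
  end.

Fact adj_mulA : associative adj_mul.
Proof. by move=> [x|] [y|] [z|] //=; rewrite mulgA. Qed.
Fact adj_mul1 : left_id None adj_mul. Proof. by []. Qed.
Fact adj_1mul : right_id None adj_mul. Proof. by case. Qed.

HB.instance Definition _ := isMonoid.Build (T^I) adj_mulA adj_mul1 adj_1mul.
End AdjoinOneMonoid.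

(* The new identity [None] is an isolated point. *)
Section AdjoinOneTopology.
Variable T : topologicalType.

Definition adj_open : set_system (T^I) :=
  [set U | open [set x : T | U (Some x)]].

Fact adj_openT : adj_open setT. Proof. exact: openT. Qed.
Fact adj_openI : setI_closed adj_open.
Proof. by move=> U W oU oW; apply: openI. Qed.
Fact adj_open_bigU (J : Type) (f : J -> set (T^I)) :
  (forall i, adj_open (f i)) -> adj_open (\bigcup_i f i).
Proof.
move=> of_; suff -> : adj_open (\bigcup_i f i) = open (\bigcup_i [set x | f i (Some x)]).
  by apply: bigcup_open => i _; exact: of_.
by congr open; apply/seteqP; split=> x [i _ fx]; exists i.
Qed.

HB.instance Definition _ :=
  isOpenTopological.Build (T^I) adj_openT adj_openI adj_open_bigU.
End AdjoinOneTopology.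

(* The projection of [I] is [I], except that it is the identity of the free
   pro-V semigroup when V consists of groups. *)
Definition rhoI (V : set finSemigroup) (A : finType) (u : (pseudoword A)^I) :
    (free_pro V A)^I :=
  match u with
  | Some w => Some (rho V w)
  | None => if pselect (all_groups V) is left gV
            then Some (free_pro_one gV A) else None
  end.

Definition eq_mod (V : set finSemigroup) (A : finType) (u v : (pseudoword A)^I) :=
  rhoI V u = rhoI V v.

(* [sigma n] holds the [n]-ary operations, elements of the free profinite
   semigroup on [n] generators. *)
Definition op_set := forall n : nat, set (pseudoword 'I_n).

Definition mul_op : pseudoword 'I_2 := gen ord0 * gen ord_max.

Definition implicit_signature (sigma : op_set) := sigma 2 mul_op.

Definition word (A : finType) (a : A) (w : seq A) : pseudoword A :=
  foldl (fun u b => u * gen b) (gen a) w.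

Definition explicit_op (n : nat) (p : pseudoword 'I_n) :=
  exists a w, p = word a w.

Section Action.
Variables (A : finType) (n : nat) (p : pseudoword 'I_n) (w : 'I_n -> pseudoword A).

Fact act_natural (S T : {S : finSemigroup | pvS S})
    (h : {multiplicative sval S -> sval T}) (s : A -> sval S) :
  op_at p (fun i => op_at (w i) (h \o s)) = h (op_at p (fun i => op_at (w i) s)).
Proof.
by rewrite -op_natural; congr op_at; apply/funext => i; rewrite op_natural.
Qed.

(* The action of [p] on the profinite semigroup of pseudowords, which is
   computed coordinatewise in its finite continuous quotients. *)
Definition act : pseudoword A := FreePro act_natural.

End Action.

Inductive sigma_word (sigma : op_set) (A : finType) : set (pseudoword A) :=
| SigmaGen a : sigma_word sigma (gen a)
| SigmaOp n (p : pseudoword 'I_n) (w : 'I_n -> pseudoword A) :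
    sigma n p -> (forall i, sigma_word sigma (w i)) -> sigma_word sigma (act p w).

Definition sigma_wordI (sigma : op_set) (A : finType) (u : (pseudoword A)^I) :=
  if u is Some w then sigma_word sigma w else True.

(* Programs for the unary partial recursive functions, with pairs coded by
   Cantor's pairing function. *)
Inductive program :=
| PZero | PSucc | PFst | PSnd
| PPair of program & program
| PComp of program & program
| PRec of program & program
| PMu of program.

Local Notation "<< x , y >>" := (Cantor.to_nat (x%N, y%N)) (at level 0).

(* [c] halts on input [x] with output [y]. *)
Fixpoint computes (c : program) (x y : nat) : Prop :=
  match c with
  | PZero => y = 0
  | PSucc => y = x.+1
  | PFst => y = (Cantor.of_nat x).1
  | PSnd => y = (Cantor.of_nat x).2
  | PPair f g => exists u v, [/\ computes f x u, computes g x v & y = <<u, v>>]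
  | PComp f g => exists2 u, computes g x u & computes f u y
  | PRec f g =>
      let a := (Cantor.of_nat x).1 in let n := (Cantor.of_nat x).2 in
      exists r : nat -> nat,
        [/\ computes f a (r 0),
            forall i, i < n -> computes g <<a, <<i, r i>> >> (r i.+1)
          & y = r n]
  | PMu f =>
      computes f <<x, y>> 0 /\
      forall i, i < y -> exists z, computes f <<x, i>> z.+1
  end.

Fixpoint program_code (c : program) : nat :=
  match c with
  | PZero => <<0, 0>>
  | PSucc => <<1, 0>>
  | PFst => <<2, 0>>
  | PSnd => <<3, 0>>
  | PPair f g => <<4, <<program_code f, program_code g>> >>
  | PComp f g => <<5, <<program_code f, program_code g>> >>
  | PRec f g => <<6, <<program_code f, program_code g>> >>
  | PMu f => <<7, program_code f>>
  end.

Definition rec_enumerable (E : set nat) :=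
  exists c, forall y, E y <-> exists x, computes c x y.

Definition ord_seq_code (m : nat) (s : seq 'I_m) : nat :=
  CodeSeq.code (map (@nat_of_ord m) s).

Definition fsg_code (S : finSemigroup) : nat :=
  <<(fsg_pred S).+1,
    ord_seq_code [seq fsg_mul x y | x <- enum 'I_(fsg_pred S).+1,
                                    y <- enum 'I_(fsg_pred S).+1]>>.

Definition rec_enumerable_class (V : set finSemigroup) :=
  rec_enumerable (fsg_code @` V).

Definition computes_op (c : program) (n : nat) (p : pseudoword 'I_n) :=
  forall (S : finSemigroup) (s : 'I_n -> S),
    computes c <<fsg_code S, ord_seq_code [seq s i | i <- enum 'I_n]>>
               (nat_of_ord (op_at (S := in_pvS S) p s)).

Definition computable_op (n : nat) (p : pseudoword 'I_n) :=
  exists c, computes_op c p.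

(* An operation is presented to an enumeration procedure by its arity and a
   program that computes it. *)
Definition names_op (y n : nat) (p : pseudoword 'I_n) :=
  exists2 c, y = <<n, program_code c>> & computes_op c p.

Definition rec_enumerable_ops (sigma : op_set) :=
  exists E : set nat, [/\ rec_enumerable E,
    forall y, E y -> exists n (p : pseudoword 'I_n), sigma n p /\ names_op y p
  & forall n (p : pseudoword 'I_n), sigma n p -> exists2 y, E y & names_op y p].

Definition highly_computable (sigma : op_set) :=
  rec_enumerable_ops sigma /\
  forall n (p : pseudoword 'I_n), sigma n p -> computable_op p.

Definition system (X : finType) := seq (pseudoword X * pseudoword X).

Definition solution (V : set finSemigroup) (X A : finType) (E : system X)
    (K : X -> set ((pseudoword A)^I))
    (delta : {multiplicative pseudoword X -> (pseudoword A)^I}) :=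
  [/\ continuous delta,
      forall e, e \in E -> eq_mod V (delta e.1) (delta e.2)
    & forall x, K x (delta (gen x))].

Definition reducible (sigma : op_set) (V : set finSemigroup)
    (C : forall X : finType, set (system X)) :=
  forall (X A : finType) (E : system X) (K : X -> set ((pseudoword A)^I)),
    C X E -> (forall x, clopen (K x)) ->
    (exists delta, solution V E K delta) ->
    exists2 delta, solution V E K delta
                 & forall x, sigma_wordI sigma (delta (gen x)).

Definition pointlike_chain (X : finType) (s : seq X) : system X :=
  [seq (gen e.1, gen e.2) | e <- zip s (behead s)].

(* A block x_1 = ... = x_n stands for the equations x_j = x_(j+1); variables may
   be shared by several blocks. *)
Definition pointlike_systems (X : finType) : set (system X) :=
  [set flatten (map (@pointlike_chain X) B) | B in [set: seq (seq X)]].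

(* Main.v *)
Require Import Defs.
From HB Require Import structures.
From mathcomp Require Import all_boot all_classical.
From mathcomp Require Import topology.

(** A map [t] from the alphabet to a finite semigroup [T] can be viewed as a
    test on words and on pseudowords.  By density, every pseudoword agrees with
    some word on any given finite set of tests, so the theorem can be argued
    almost entirely with words.

    Fix a test [phi : A -> P] that is fine enough to decide the constraints and
    to detect the content (set of letters) of a word.  A tuple [s] of values of
    [phi] is pointlike for a class V when, for each test in V, it is the tuple
    of [phi]-values of words that the test identifies.  It is realized when it
    is the tuple of [phi]-values of sigma-words that are equal modulo DRH.  A
    solution modulo DRH yields pointlike tuples ([eq_mod_pointlike]), one for
    each class of variables with the same value modulo DRH, and the theorem
    amounts to the fact that pointlike tuples for DRH are realized
    ([pointlike_realized]).

    Let B be the common content of the pointlike tuple [s]; we use induction on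
    the size of B.  A word with content B factors uniquely as [w0 ++ a :: w1],
    where [a] is the letter that occurs last for the first time (left basic
    factorization).  For T in DRH there is a larger test in DRH under which the
    value of a word determines [a] and the T-values of [w0] and [w1]
    ([lbf_test]).  Hence [s = s0 * phi a * s1] with [s0] and [s1] pointlike
    ([pointlike_step]).  The content of [s0] is smaller than B, so [s0 * phi a]
    is realized by induction, and so is [s1] when its content is not B.  If [s]
    were not realized, [s1] would thus be a pointlike tuple of content B that
    is not realized, and one could factor again without end.  There are
    finitely many tuples, so the chain of remainders has a cycle, that is a
    pointlike tuple [s] of content B, not realized, with [s = q * s] for some
    realized tuple [q] of content B.

    That is impossible ([realized_absorb]).  Since [s] is pointlike for DRH it
    is pointlike for H; compactness ([pointlike_limit]) turns this into a
    solution of a pointlike system modulo H, and the reducibility of H gives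
    sigma-words [r] with value [s] that are equal modulo H.  A non-explicit
    operation of sigma, applied with all arguments equal to [v], acts in each
    finite semigroup as an arbitrarily large power of [v]
    ([nonexplicit_long]).  Applied to sigma-words that realize [q], it gives
    sigma-words [y] whose value in every member of DRH is regular.  A regular
    R-class of a member of DRH is a group in H, on which a letter of B acts
    from the right as an element of that group, so the value of [y * r] there
    depends on [r] only modulo H ([DRH_absorb]).  Hence the products [y * r]
    are equal modulo DRH, while their [phi]-value is a power of [q] times [s],
    which is [s]. *)

Set Implicit Arguments.
Unset Strict Implicit.
Unset Printing Implicit Defensive.

Local Open Scope classical_set_scope.
Local Open Scope group_scope.

(** * Values of words and quotients of the free semigroup *)

HB.instance Definition _ (T : finType) := Finite.copy (T^I) (option T).

Definition mk_hom (G H : magmaType) (f : G -> H) (fM : {morph f : x y / x * y}) :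
    {multiplicative G -> H} :=
  HB.pack f (isMultiplicative.Build G H f fM).

Lemma someM (T : semigroupType) (x y : T) : (Some x : T^I) * Some y = Some (x * y).
Proof. by []. Qed.

Section Eval.
Variables (A : Type) (T : semigroupType) (t : A -> T).

(** The value is taken in [T^I] so that the empty word has one. *)
Definition ev (w : seq A) : T^I := foldr (fun a x => (Some (t a) : T^I) * x) 1 w.

Lemma ev_cat w z : ev (w ++ z) = ev w * ev z.
Proof. by elim: w => [|a w IH] /=; rewrite ?mul1g // IH mulgA. Qed.

Lemma ev_some w : w <> [::] -> exists x, ev w = Some x.
Proof. by case: w => // a w _ /=; case: (ev w) => [x|]; eexists. Qed.

Lemma ev_none w : ev w = None -> w = [::].
Proof. by case: w => // a w /=; case: (ev w). Qed.

Lemma ev1 a : ev [:: a] = Some (t a). Proof. by []. Qed.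
End Eval.

Lemma ev_hom (A : Type) (S T : semigroupType) (h : {multiplicative S -> T})
    (t : A -> S) (w : seq A) : ev (h \o t) w = omap h (ev t w).
Proof.
elim: w => //= a w ->; case: (ev t w) => [x|] //=.
by rewrite gmulfM.
Qed.

Section Table.
Variables (F : finType) (mul : F -> F -> F) (mulA : associative mul) (x0 : F).

Fact card_table : #|F| = #|F|.-1.+1.
Proof. by rewrite prednK //; apply/card_gt0P; exists x0. Qed.

Definition table_enc (x : F) : 'I_#|F|.-1.+1 := cast_ord card_table (enum_rank x).
Definition table_dec (i : 'I_#|F|.-1.+1) : F := enum_val (cast_ord (esym card_table) i).

Lemma table_encK : cancel table_enc table_dec.
Proof. by move=> x; rewrite /table_dec /table_enc cast_ordK enum_rankK. Qed.
Lemma table_decK : cancel table_dec table_enc.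
Proof. by move=> x; rewrite /table_dec /table_enc enum_valK cast_ordKV. Qed.

Definition table_mul i j := table_enc (mul (table_dec i) (table_dec j)).
Fact table_mulA : associative table_mul.
Proof. by move=> i j k; rewrite /table_mul !table_encK mulA. Qed.

Definition table : finSemigroup := FinSemigroup table_mulA.

Lemma table_encM x y : table_enc (mul x y) = (table_enc x : table) * table_enc y.
Proof. by rewrite [RHS]/(table_mul _ _) /table_mul !table_encK. Qed.
Lemma table_decM (i j : table) : table_dec (i * j) = mul (table_dec i) (table_dec j).
Proof. exact: table_encK. Qed.
End Table.

(** The congruence of [s] on words is contained in that of [t]. *)
Definition finer (A : Type) (S T : semigroupType) (s : A -> S) (t : A -> T) :=
  forall w z, ev s w = ev s z -> ev t w = ev t z.

Definition generated (A : Type) (T : semigroupType) (t : A -> T) :=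
  forall x : T, exists w, ev t w = Some x.

Definition word_congruence (A F : Type) (alpha : seq A -> F) :=
  forall w w' z z', alpha w = alpha w' -> alpha z = alpha z' ->
    alpha (w ++ z) = alpha (w' ++ z').

Lemma ev_congruence (A : Type) (T : semigroupType) (t : A -> T) :
  word_congruence (ev t).
Proof. by move=> w w' z z'; rewrite !ev_cat => -> ->. Qed.

Lemma pair_congruence (A F G : Type) (f : seq A -> F) (g : seq A -> G) :
  word_congruence f -> word_congruence g -> word_congruence (fun w => (f w, g w)).
Proof.
move=> fC gC w w' z z' [fw gw] [fz gz]; congr (_, _); [exact: fC|exact: gC].
Qed.

(** The carrier is the image of the nonempty words under [alpha]; its product
    concatenates chosen representatives, which is well defined because [alpha]
    is compatible with concatenation.  All the finite semigroups that depend on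
    combinatorics of words are built in this way, so that their properties can
    be checked on words. *)
Lemma word_quotient (A F : finType) (alpha : seq A -> F) (a0 : A) :
  word_congruence alpha ->
  exists (T : finSemigroup) (t : A -> T), generated t /\
    forall w w', w <> [::] -> w' <> [::] -> ev t w = ev t w' <-> alpha w = alpha w'.
Proof.
move=> alphaC.
pose D := {x : F | `[< exists2 w, w <> [::] & alpha w = x >]}.
pose cls w (wn : w <> [::]) : D :=
  exist _ (alpha w) (asboolT (ex_intro2 _ (fun z => alpha z = alpha w) w wn erefl)).
have repP (d : D) : exists2 w, w <> [::] & alpha w = val d by case: d => x /= /asboolP.
pose rep d := sval (cid2 (repP d)).
have repn d : rep d <> [::] by rewrite /rep; case: cid2.
have repE d : alpha (rep d) = val d by rewrite /rep; case: cid2.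
have catn w z : w <> [::] -> w ++ z <> [::] :> seq A by case: w.
pose mul (d e : D) : D := cls _ (catn _ (rep e) (repn d)).
have mulA : associative mul.
  move=> d e f; apply: val_inj => /=.
  rewrite (alphaC _ (rep d) _ (rep e ++ rep f)) ?repE //.
  by rewrite catA; apply: alphaC; rewrite ?repE.
have an (a : A) : [:: a] <> [::] by [].
pose T := table mulA (cls _ (an a0)).
pose t a : T := table_enc (cls _ (an a0)) (cls _ (an a)).
have tE w : w <> [::] ->
    exists2 d : D, val d = alpha w & ev t w = Some (table_enc (cls _ (an a0)) d : T).
  elim: w => // a w IH _; have [->|wn] := pselect (w = [::]); first by exists (cls _ (an a)).
  have [d dE /= ->] := IH wn; exists (mul (cls _ (an a)) d).
    by apply: (alphaC _ [:: a] _ w); rewrite repE.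
  by congr Some; rewrite table_encM.
exists T, t; split.
  move=> x; have [d dE tw] := tE _ (repn (table_dec (cls _ (an a0)) x)).
  exists (rep (table_dec (cls _ (an a0)) x)); rewrite tw; congr Some.
  by rewrite -[RHS](table_decK (cls _ (an a0))); congr table_enc; apply: val_inj; rewrite dE repE.
move=> w w' wn wn'; have [d dE ->] := tE _ wn; have [d' dE' ->] := tE _ wn'.
rewrite -dE -dE'; split=> [e|/val_inj -> //].
by have /= := congr1 (omap (table_dec (cls _ (an a0)))) e; rewrite !table_encK => -[->].
Qed.

(** An element of [T0] is the value of a word [w]; it is sent to the value of
    [w] in [T], which does not depend on the choice of [w]. *)
Lemma hom_of_finer (A : Type) (T0 T : semigroupType) (t0 : A -> T0) (t : A -> T) :
  generated t0 -> finer t0 t -> exists h : {multiplicative T0 -> T}, h \o t0 = t.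
Proof.
move=> gen0 fin.
have hP (x : T0) : exists y, exists2 w, ev t0 w = Some x & ev t w = Some y.
  have [w wx] := gen0 x.
  have [|y wy] := @ev_some _ _ t w; first by move=> w0; rewrite w0 in wx.
  by exists y, w.
have [h hE] := choice hP.
have hw w x : ev t0 w = Some x -> ev t w = Some (h x).
  by move=> wx; have [z zx <-] := hE x; apply: fin; rewrite wx.
have hM : {morph h : x y / x * y}.
  move=> x y; have [w wx] := gen0 x; have [z zy] := gen0 y.
  have := hw (w ++ z) (x * y); rewrite !ev_cat wx zy => /(_ erefl).
  by rewrite (hw _ _ wx) (hw _ _ zy) => -[].
exists (mk_hom hM); apply/funext => a /=.
by have [] := hw _ _ (ev1 t0 a).
Qed.

(** * Pseudowords as limits of words *)

Section Value.
Variable A : finType.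

Definition val_at (T : finSemigroup) (t : A -> T) (u : pseudoword A) : T :=
  op_at (S := in_pvS T) u t.

Definition valI (T : finSemigroup) (t : A -> T) (u : (pseudoword A)^I) : T^I :=
  omap (val_at t) u.

Lemma val_at_hom (S T : finSemigroup) (h : {multiplicative S -> T}) (t : A -> S) u :
  val_at (h \o t) u = h (val_at t u).
Proof. exact: (@op_natural _ _ u (in_pvS S) (in_pvS T) h t). Qed.

Lemma op_at_val (u : pseudoword A) (S : {S : finSemigroup | pvS S}) (s : A -> sval S) :
  op_at u s = val_at s u.
Proof. by case: S s => S []. Qed.

Lemma val_at_inj (u v : pseudoword A) :
  (forall (T : finSemigroup) (t : A -> T), val_at t u = val_at t v) -> u = v.
Proof. by move=> uv; apply: free_pro_eq => S s; rewrite !op_at_val. Qed.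

Lemma valIM (T : finSemigroup) (t : A -> T) (u v : (pseudoword A)^I) :
  valI t (u * v) = valI t u * valI t v.
Proof. by case: u v => [u|] [v|]. Qed.

Lemma valI_none (T : finSemigroup) (t : A -> T) (u : (pseudoword A)^I) :
  valI t u = None -> u = None.
Proof. by case: u. Qed.

(** On an empty alphabet an implicit operation would be a constant fixed by all
    homomorphisms; in a two-element left zero band, where constant maps are
    homomorphisms, it would be equal to both elements. *)
Lemma pseudoword_letter (u : pseudoword A) : exists a : A, True.
Proof.
apply: contrapT => noA.
pose T := table (F := bool) (mul := fun x _ => x) (fun x y z => erefl) true.
have constM (c : T) : {morph (fun _ : T => c) : x y / x * y}.
  by move=> _ _; rewrite -[LHS](table_decK true) -[RHS](table_decK true) table_decM.
have t0 : A -> T by move=> a; case: noA; exists a.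
have valE (c : T) : val_at t0 u = c.
  rewrite -[RHS](val_at_hom (mk_hom (constM c)) t0 u); congr (val_at _ u).
  by apply/funext => a; case: noA; exists a.
have := valE (table_enc true true); rewrite (valE (table_enc true false)).
by move/(can_inj (table_encK true)).
Qed.

(** In the quotient by [alpha], which is generated by the letters, the value of
    [u] is that of a word; naturality transports this to all coarser tests. *)
Lemma pseudoword_dense (F : finType) (alpha : seq A -> F) (u : pseudoword A) :
  word_congruence alpha ->
  exists2 w, w <> [::] & forall (T : finSemigroup) (t : A -> T),
    (forall z z', alpha z = alpha z' -> ev t z = ev t z') ->
    ev t w = Some (val_at t u).
Proof.
move=> alphaC; have [a0 _] := pseudoword_letter u.
have [T0 [t0 [gen0 t0E]]] := word_quotient a0 alphaC.
have [w wE] := gen0 (val_at t0 u).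
have wn : w <> [::] by move=> w0; rewrite w0 in wE.
exists w => // T t fin.
have [|h hE] := @hom_of_finer _ _ _ t0 t gen0.
  move=> z z' e; have [z0|zn] := pselect (z = [::]).
    by move: e; rewrite z0 => /esym/ev_none ->.
  apply: fin; apply/t0E => // z0; apply: zn.
  by move: e; rewrite z0 => /ev_none.
by rewrite -hE val_at_hom ev_hom wE.
Qed.

Lemma valI_dense3 (T1 T2 T3 : finSemigroup) (t1 : A -> T1) (t2 : A -> T2) (t3 : A -> T3)
    (u : (pseudoword A)^I) :
  exists w, [/\ ev t1 w = valI t1 u, ev t2 w = valI t2 u & ev t3 w = valI t3 u].
Proof.
case: u => [u|]; last by exists [::].
pose alpha w : (T1^I * T2^I * T3^I)%type := (ev t1 w, ev t2 w, ev t3 w).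
have alphaC : word_congruence alpha.
  by apply: pair_congruence; [apply: pair_congruence|]; exact: ev_congruence.
have [w _ wE] := pseudoword_dense u alphaC.
by exists w; split; apply: wE => z z' [].
Qed.

Lemma valI_dense2 (T1 T2 : finSemigroup) (t1 : A -> T1) (t2 : A -> T2)
    (u : (pseudoword A)^I) :
  exists w, ev t1 w = valI t1 u /\ ev t2 w = valI t2 u.
Proof. by have [w []] := valI_dense3 t1 t2 t2 u; exists w. Qed.

Lemma sigma_wordI_mul (sigma : op_set) (u v : (pseudoword A)^I) :
  implicit_signature sigma -> sigma_wordI sigma u -> sigma_wordI sigma v ->
  sigma_wordI sigma (u * v).
Proof.
case: u v => [u|] [v|] // sm su sv.
pose f (i : 'I_2) := if i == ord0 then u else v.
change (sigma_word sigma (u * v : pseudoword A)); suff -> : u * v = act mul_op f.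
  by apply: SigmaOp => // i; rewrite /f; case: eqP.
by apply: val_at_inj.
Qed.

End Value.

Lemma ultra_finite (J : Type) (U : set_system J) (F : finType) (f : J -> F) :
  UltraFilter U -> exists x, U [set j | f j = x].
Proof.
move=> UU; apply: contrapT => /forallNP nU.
suff : forall s : seq F, U [set j | f j \notin s].
  move=> /(_ (enum F)) /(@filter_ex _ _ _)[j] /=.
  by rewrite mem_enum.
elim=> [|x s IH]; first by apply: filterS filterT => j.
have [/nU //|nx] := in_ultra_setVsetC [set j | f j = x] UU.
apply: filterS2 nx IH => j /= /eqP fx fs.
by rewrite inE negb_or fx.
Qed.

(** An ultrafilter selects one value in each finite semigroup, and homomorphisms
    preserve the selected values; the family of these values is therefore an
    implicit operation.  This is the form in which the compactness
    of the space of pseudowords is used. *)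
Lemma pseudoword_limit (A : finType) (J : Type) (U : set_system J) (w : J -> seq A) :
  UltraFilter U -> (forall j, w j <> [::]) ->
  exists u : pseudoword A, forall (T : finSemigroup) (t : A -> T) c,
    U [set j | ev t (w j) = Some c] -> val_at t u = c.
Proof.
move=> UU wn.
have limP (Tt : {T : finSemigroup & A -> T}) : exists c, U [set j | ev (tagged Tt) (w j) = Some c].
  have [[c|] Uc] := ultra_finite (fun j => ev (tagged Tt) (w j)) UU; first by exists c.
  by have /filter_ex [j /= /ev_none /wn] := Uc.
pose lim (T : finSemigroup) (t : A -> T) : T := projT1 (cid (limP (existT _ T t))).
have limE (T : finSemigroup) (t : A -> T) : U [set j | ev t (w j) = Some (lim T t)].
  exact: (projT2 (cid (limP (existT _ T t)))).
have limU (T : finSemigroup) (t : A -> T) c : U [set j | ev t (w j) = Some c] -> lim T t = c.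
  move=> Uc; have /filter_ex [j /= [e1 e2]] : U ([set j | ev t (w j) = Some (lim T t)] `&`
      [set j | ev t (w j) = Some c]) by apply: filterI.
  by move: e1; rewrite e2 => -[].
have nat (S T : {S : finSemigroup | pvS S}) (h : {multiplicative sval S -> sval T})
    (s : A -> sval S) : lim (sval T) (h \o s) = h (lim (sval S) s).
  by apply: limU; apply: filterS (limE _ s) => j /=; rewrite ev_hom => ->.
by exists (FreePro nat) => T t c /limU.
Qed.

(** * Products of tests and the R-classes of regular elements *)

Definition trivial_table : finSemigroup :=
  table (mul := fun _ _ : unit => tt) (fun _ _ _ => erefl) tt.

Lemma trivial_tableP (x y : trivial_table) : x = y.
Proof.
by apply: (can_inj (@table_decK _ tt)); case: (table_dec tt x); case: (table_dec tt y).
Qed.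

Section ProdTable.
Variables S T : finSemigroup.

Definition prod_mul (x y : (S * T)%type) : (S * T)%type := (x.1 * y.1, x.2 * y.2).
Fact prod_mulA : associative prod_mul.
Proof. by move=> [? ?] [? ?] [? ?]; rewrite /prod_mul /= !mulgA. Qed.

Definition prod_base : (S * T)%type := (ord0, ord0).
Definition prod_table := table prod_mulA prod_base.
Definition prod_enc (x : (S * T)%type) : prod_table := table_enc prod_base x.
Definition prod_dec (x : prod_table) : (S * T)%type := table_dec prod_base x.

Lemma prod_encK : cancel prod_enc prod_dec. Proof. exact: table_encK. Qed.
Lemma prod_decK : cancel prod_dec prod_enc. Proof. exact: table_decK. Qed.

Fact prod_decM : {morph prod_dec : x y / x * y}.
Proof. by move=> x y; rewrite /prod_dec table_decM. Qed.

Lemma prod_table_in (V : set finSemigroup) :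
  pseudovariety V -> V S -> V T -> V prod_table.
Proof.
move=> pV; apply: (pv_prod pV (h := mk_hom prod_decM)).
by exists prod_enc; [exact: prod_decK|exact: prod_encK].
Qed.

Lemma prod_mulE x y : prod_dec (x * y) = ((prod_dec x).1 * (prod_dec y).1,
  (prod_dec x).2 * (prod_dec y).2).
Proof. by rewrite prod_decM. Qed.

End ProdTable.

Lemma finer_trans (A : Type) (S T U : semigroupType) (s : A -> S) (t : A -> T) (u : A -> U) :
  finer s t -> finer t u -> finer s u.
Proof. by move=> st tu w z /st/tu. Qed.

Lemma finer_hom (A : Type) (S T : semigroupType) (s : A -> S) (h : {multiplicative S -> T}) :
  finer s (h \o s).
Proof. by move=> w z; rewrite !ev_hom => ->. Qed.

Lemma finer_prod (A : Type) (S T : finSemigroup) (s : A -> S) (t : A -> T) :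
  let st := fun a => prod_enc (s a, t a) in finer st s /\ finer st t.
Proof.
move=> st.
have fM : {morph (fun x : prod_table S T => (prod_dec x).1) : x y / x * y}.
  by move=> x y; rewrite prod_mulE.
have sM : {morph (fun x : prod_table S T => (prod_dec x).2) : x y / x * y}.
  by move=> x y; rewrite prod_mulE.
have d : s = mk_hom fM \o st by apply/funext => a /=; rewrite prod_encK.
have e : t = mk_hom sM \o st by apply/funext => a /=; rewrite prod_encK.
by split; [rewrite d|rewrite e]; exact: finer_hom.
Qed.

(** An idempotent [e] is a left identity of its principal right ideal. *)
Lemma greenR_idem (T : semigroupType) (e x : T) :
  e * e = e -> greenR e x <-> e * x = x /\ exists y, x * y = e.
Proof.
move=> ee; split=> [[ex xe]|[ex [y xy]]].
  split; first by case: ex => [->//|[z ->]]; rewrite mulgA ee.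
  by case: xe => [<-|[y ->]]; [exists e|exists y].
by split; right; [exists x|exists y].
Qed.

(** If [a = a z a] then [a z] is an idempotent in the R-class of [a]. *)
Lemma greenR_regular (T : semigroupType) (a z x : T) :
  a * z * a = a -> greenR a x <-> greenR (a * z) x.
Proof.
move=> aza; have ee : a * z * (a * z) = a * z by rewrite mulgA aza.
rewrite (greenR_idem _ ee).
split=> [[ax xa]|[ax [y xy]]].
  split; first by case: ax => [->//|[y ->]]; rewrite mulgA aza.
  by case: xa => [<-|[y ->]]; [exists z|exists (y * z); rewrite mulgA].
split; right; first by exists (z * x); rewrite mulgA.
by exists (y * a); rewrite mulgA xy.
Qed.

(** * Membership in DRH *)

Section DRH.
Variables (H : set finSemigroup) (HG : pseudovariety_of_groups H).
Let HV : pseudovariety H := HG.1.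

(** Embeds the R-class of [e] into a group of H; the values of [h] outside that
    R-class are arbitrary, which avoids partial functions. *)
Definition group_chart (S : finSemigroup) (e : S) (G : finSemigroup) (h : S -> G) :=
  [/\ H G, forall x y, greenR e x -> greenR e y -> h (x * y) = h x * h y &
      forall x y, greenR e x -> greenR e y -> h x = h y -> x = y].

(** If [x e = x] for every [x] in the R-class of an idempotent [e], that R-class
    is closed under products, because [x y] is R-related to [x e = x].  As a
    subsemigroup of a group of H it then belongs to H. *)
Lemma DRH_intro (S : finSemigroup) :
  (forall e : S, e * e = e -> (forall x, greenR e x -> x * e = x) /\
     exists (G : finSemigroup) (h : S -> G), group_chart e h) -> DRH H S.
Proof.
move=> chart a [z aza].
have ee : a * z * (a * z) = a * z by rewrite mulgA aza.
rewrite (_ : [set b | greenR a b] = [set b | greenR (a * z) b]); last first.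
  by apply/seteqP; split=> b /=; rewrite (greenR_regular _ aza).
move: (a * z) ee => e ee {a z aza}.
have [xe [G [h [HGr hM hinj]]]] := chart e ee.
pose D := {x : S | `[< greenR e x >]}.
have DP (d : D) : greenR e (val d) by case: d => x /= /asboolP.
have eR : greenR e e by apply/(greenR_idem _ ee); split=> //; exists e.
pose mkD x (xR : greenR e x) : D := exist _ x (asboolT xR).
have Dmul (x y : S) : greenR e x -> greenR e y -> greenR e (x * y).
  move=> /[dup] /xe xE /(greenR_idem _ ee)[ex [x' xx']] /(greenR_idem _ ee)[ey [y' yy']].
  apply/(greenR_idem _ ee); split; first by rewrite mulgA ex.
  by exists (y' * x'); rewrite mulgA -[x * y * y']mulgA yy' xE.
pose mul (c d : D) := mkD _ (Dmul _ _ (DP c) (DP d)).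
have mulA : associative mul by move=> c d f; apply: val_inj => /=; rewrite mulgA.
pose d0 := mkD e eR.
pose G' := table mulA d0.
pose f (x : G') : S := val (table_dec d0 x).
have fM : {morph f : x y / x * y} by move=> x y; rewrite /f table_decM.
have fR x : greenR e (f x) by exact: DP.
have finj : injective f.
  by move=> x y /val_inj; apply: (can_inj (@table_decK _ d0)).
have hfM : {morph h \o f : x y / x * y} by move=> x y /=; rewrite fM hM.
have hfinj : injective (h \o f) by move=> x y /= /hinj; move=> /(_ (fR x) (fR y))/finj.
exists G'; first exact: (pv_sub HV (h := mk_hom hfM)).
exists (mk_hom fM) => //.
apply/seteqP; split=> [_ [x _ <-] /=|x xR]; first exact: fR.
by exists (table_enc d0 (mkD x xR)) => //=; rewrite /f table_encK.
Qed.

Lemma DRH_elim (S : finSemigroup) (e : S) : DRH H S -> e * e = e ->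
  exists (G : finSemigroup) (g : {multiplicative G -> S}) (h : S -> G),
  [/\ H G, injective g, forall x, greenR e x <-> exists y, g y = x &
      forall x, greenR e x -> g (h x) = x].
Proof.
move=> SH ee; have [|G HGr [g ginj gE]] := SH e; first by exists e; rewrite ee ee.
have gP x : greenR e x <-> exists y, g y = x.
  rewrite -[greenR e x]/([set b | greenR e b] x) -gE.
  by split=> [[y _ <-]|[y <-]]; exists y.
have /choice [h hE] (x : S) : exists y : G, greenR e x -> g y = x.
  have [/gP[y yx]|nx] := pselect (greenR e x); first by exists y.
  by exists ord0 => /nx.
by exists G, g, h.
Qed.

Lemma DRH_chart (S : finSemigroup) (e : S) : DRH H S -> e * e = e ->
  (forall x, greenR e x -> x * e = x) /\
  exists (G : finSemigroup) (h : S -> G), group_chart e h.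
Proof.
move=> SH ee; have [G [g [h [HGr ginj gP hK]]]] := DRH_elim SH ee.
have eR : greenR e e by apply/(greenR_idem _ ee); split=> //; exists e.
split=> [x xR|].
  have [u u1 uinv] := HG.2 _ HGr; have [y ye] := (gP e).1 eR.
  have [z [_ zy]] := uinv y.
  have yy : y * y = y by apply: ginj; rewrite gmulfM ye ee.
  have yu : y = u by rewrite -zy -{2}yy mulgA zy (u1 y).1.
  by have [x' <-] := (gP x).1 xR; rewrite -ye -gmulfM yu (u1 x').2.
exists G, h; split=> // x y xR yR; last by move=> hxy; rewrite -(hK x) // hxy hK.
apply: ginj; rewrite gmulfM !hK //.
by apply/gP; exists (h x * h y); rewrite gmulfM !hK.
Qed.

Lemma DRH_prod (S T : finSemigroup) : DRH H S -> DRH H T -> DRH H (prod_table S T).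
Proof.
move=> SH TH; apply: DRH_intro => e ee.
pose e1 := (prod_dec e).1; pose e2 := (prod_dec e).2.
have ee1 : e1 * e1 = e1.
  by have := congr1 (fun x => (prod_dec x).1) ee; rewrite prod_mulE.
have ee2 : e2 * e2 = e2.
  by have := congr1 (fun x => (prod_dec x).2) ee; rewrite prod_mulE.
have [xe1 [G1 [h1 [HG1 hM1 hi1]]]] := DRH_chart SH ee1.
have [xe2 [G2 [h2 [HG2 hM2 hi2]]]] := DRH_chart TH ee2.
have xR x : greenR e x -> greenR e1 (prod_dec x).1 /\ greenR e2 (prod_dec x).2.
  move=> /(greenR_idem _ ee)[ex [y xy]]; split.
    apply/(greenR_idem _ ee1); split; first by rewrite -{2}ex prod_mulE.
    by exists (prod_dec y).1; rewrite /e1 -xy prod_mulE.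
  apply/(greenR_idem _ ee2); split; first by rewrite -{2}ex prod_mulE.
  by exists (prod_dec y).2; rewrite /e2 -xy prod_mulE.
have dec_eq (x y : prod_table S T) : (prod_dec x).1 = (prod_dec y).1 ->
    (prod_dec x).2 = (prod_dec y).2 -> x = y.
  move=> a b; apply: (can_inj (@prod_decK S T)).
  by rewrite [LHS]surjective_pairing a b -surjective_pairing.
split=> [x /xR[x1 x2]|].
  by apply: dec_eq; rewrite prod_mulE /= ?xe1 ?xe2.
exists (prod_table G1 G2), (fun x => prod_enc (h1 (prod_dec x).1, h2 (prod_dec x).2)).
split; first exact: prod_table_in.
  move=> x y /xR[x1 x2] /xR[y1 y2].
  by apply: (can_inj (@prod_decK _ _)); rewrite !prod_mulE !prod_encK /= hM1 // hM2.
move=> x y /xR[x1 x2] /xR[y1 y2] /(can_inj (@prod_encK _ _)) [a b].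
by apply: dec_eq; [exact: hi1|exact: hi2].
Qed.

Lemma trivial_table_in : H trivial_table.
Proof.
have [S HS] := pv_nonempty HV.
have cM : {morph (fun _ : S => ord0 : trivial_table) : x y / x * y}.
  by move=> x y; exact: trivial_tableP.
by apply: (pv_quotient HV (h := mk_hom cM)) HS => y; exists ord0; exact: trivial_tableP.
Qed.

(** In a group the only idempotent is the identity, whose R-class is the whole
    group. *)
Lemma DRH_group (S : finSemigroup) : H S -> DRH H S.
Proof.
move=> HS; have [u u1 uinv] := HG.2 _ HS.
apply: DRH_intro => e ee; split; last by exists S, id.
have [y [_ ye]] := uinv e.
have -> : e = u by rewrite -ye -{2}ee mulgA ye (u1 e).1.
by move=> x _; exact: (u1 x).2.
Qed.

Lemma DRH_trivial : DRH H trivial_table.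
Proof. exact/DRH_group/trivial_table_in. Qed.

(** A two-element left zero band has only trivial R-classes.  As a consequence,
    modulo DRH the empty word is equal to no pseudoword. *)
Lemma DRH_nongroup : ~ all_groups (DRH H).
Proof.
pose S := table (mul := fun x y : bool => x) (fun x y z => erefl) true.
have mulE (x y : S) : x * y = x.
  by apply: (can_inj (@table_decK _ true)); rewrite table_decM.
have SH : DRH H S.
  apply: DRH_intro => e ee; split=> //.
  exists trivial_table, (fun=> ord0); split.
  - exact: trivial_table_in.
  - by move=> x y _ _; exact: trivial_tableP.
  move=> x y.
  by move=> /(greenR_idem _ ee)[+ _] /(greenR_idem _ ee)[+ _] _; rewrite !mulE => <- <-.
move=> /(_ S SH) [u u1 _].
have ue x : x = u by rewrite -(u1 x).1 mulE.
have := ue (table_enc true true); rewrite -(ue (table_enc true false)).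
by move=> /(can_inj (@table_encK _ true)).
Qed.

End DRH.

(** * Left basic factorizations *)

Section LeftBasicFactorization.
Variable A : finType.
Implicit Types (C : {set A}) (w z : seq A).

Definition content w : {set A} := finset (fun a => a \in w).

Lemma in_content w a : (a \in content w) = (a \in w).
Proof. by rewrite inE. Qed.

Lemma content_nil : content [::] = finset.set0.
Proof. by apply/finset.setP => a; rewrite !inE. Qed.

Lemma content_cat w z : content (w ++ z) = (content w :|: content z)%SET.
Proof. by apply/finset.setP => a; rewrite !inE mem_cat. Qed.

Lemma content_cons a w : content (a :: w) = (a |: content w)%SET.
Proof. by apply/finset.setP => b; rewrite !inE. Qed.

(** The factorization [w0 ++ a :: w1] of a word where [a] is the last letter to
    occur for the first time, letters of [C] being regarded as already seen.
    The parameter [C] makes the factorization of a product computable from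
    those of the factors ([lbf_cat]). *)
Fixpoint lbf C w : option (seq A * A * seq A) :=
  if w is a :: w' then
    match lbf (a |: C)%SET w' with
    | Some (w0, b, w1) => Some (a :: w0, b, w1)
    | None => if a \in C then None else Some ([::], a, w')
    end
  else None.

Lemma lbf_none C w : content w \subset C -> lbf C w = None.
Proof.
elim: w C => //= a w IH C; rewrite content_cons finset.subUset finset.sub1set => /andP[aC wC].
by rewrite IH ?aC // (fintype.subset_trans wC) // finset.subsetUr.
Qed.

Lemma lbf_none_content C w : lbf C w = None -> content w \subset C.
Proof.
elim: w C => [|a w IH] C /=; first by rewrite content_nil ?finset.sub0set.
case e : lbf => [[[? ?] ?]|] //; case: ifP => // aC _.
move: (IH _ e); rewrite content_cons (_ : (a |: C)%SET = C).
  by rewrite finset.subUset finset.sub1set aC.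
by apply/finset.setUidPr; rewrite finset.sub1set.
Qed.

Lemma lbf_some C w w0 a w1 : lbf C w = Some (w0, a, w1) ->
  [/\ w = w0 ++ a :: w1, a \notin C, a \notin content w0 &
      content w \subset (a |: (C :|: content w0))%SET].
Proof.
elim: w C w0 => //= b w IH C w0; case e : lbf => [[[z0 c] z1]|].
  move=> [<- ca cw1]; rewrite ca cw1 in e; have [wE] := IH _ _ e.
  rewrite !inE negb_or => /andP[ab aC] aw0 /fintype.subsetP sub; split=> //; first by rewrite wE.
    by rewrite negb_or ab.
  rewrite content_cons; apply/fintype.subsetP => d; rewrite !inE => /orP[->|dw].
    by rewrite !orbT.
  have := sub d; rewrite !inE => /(_ dw).
  by case: (d == a) => //=; case: (d == b); rewrite ?orbT.
case: ifP => // bC [<- <- <-]; split; rewrite ?bC ?inE //.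
move: (lbf_none_content e); rewrite content_cons !finset.subUset finset.sub1set !inE eqxx /=.
move=> /fintype.subset_trans-> //.
by rewrite content_nil ?finset.setU0.
Qed.

Lemma lbf_cat C w z : lbf C (w ++ z) =
  match lbf (C :|: content w)%SET z with
  | Some (z0, b, z1) => Some (w ++ z0, b, z1)
  | None => omap (fun f => (f.1.1, f.1.2, f.2 ++ z)) (lbf C w)
  end.
Proof.
elim: w C => [|a w IH] C /=.
  rewrite content_nil finset.setU0.
  by case: lbf => [[[? ?] ?]|].
rewrite IH content_cons finset.setUA [(C :|: _)%SET]finset.setUC.
case: (lbf _ z) => [[[? ?] ?]|] //; case: (lbf _ w) => [[[? ?] ?]|] //=.
by case: ifP.
Qed.

Section Data.
Variables (T : finSemigroup) (t : A -> T).

(** The contents are kept along with the values: they decide which branch of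
    [lbf_cat] applies. *)
Definition lbf_data w : T^I * {set A} * {ffun {set A} -> option (T^I * A * T^I * {set A})} :=
  (ev t w, content w,
   [ffun C => omap (fun f => (ev t f.1.1, f.1.2, ev t f.2, content f.2)) (lbf C w)]).

Lemma lbf_dataP w w' C : lbf_data w = lbf_data w' ->
  match lbf C w, lbf C w' with
  | Some (w0, a, w1), Some (w0', a', w1') =>
      [/\ ev t w0 = ev t w0', a = a', ev t w1 = ev t w1' & content w1 = content w1']
  | None, None => True
  | _, _ => False
  end.
Proof.
move=> [_ _ /ffunP/(_ C)]; rewrite !ffunE.
by case: lbf => [[[? ?] ?]|]; case: lbf => [[[? ?] ?]|] //= [].
Qed.

Lemma lbf_data_congruence : word_congruence lbf_data.
Proof.
move=> w w' z z' ww' zz'; have [ew cw _] := ww'; have [ez cz _] := zz'.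
rewrite /lbf_data !ev_cat !content_cat ew ez cw cz; congr (_, _).
apply/ffunP => C; rewrite !ffunE !lbf_cat cw.
have := lbf_dataP (C :|: content w')%SET zz'.
case: lbf => [[[? ?] ?]|]; case: lbf => [[[? ?] ?]|] //=.
  by move=> [e1 -> -> ->]; rewrite !ev_cat ew e1.
move=> _; have := lbf_dataP C ww'.
case: lbf => [[[? ?] ?]|]; case: lbf => [[[? ?] ?]|] //=.
by move=> [-> -> e1 e2]; rewrite !ev_cat !content_cat e1 e2 ez cz.
Qed.

(** When [z] brings no letter that is missing from [w], the factorizations of
    [w ++ z] are those of [w] with [z] appended to the last factor. *)
Lemma lbf_data_absorb w z z' : content z \subset content w -> content z = content z' ->
  ev t z = ev t z' -> lbf_data (w ++ z) = lbf_data (w ++ z').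
Proof.
move=> zw cz ez; rewrite /lbf_data !ev_cat !content_cat ez cz; congr (_, _).
have zC C : content z \subset (C :|: content w)%SET.
  exact: fintype.subset_trans zw (finset.subsetUr _ _).
apply/ffunP => C; rewrite !ffunE !lbf_cat (lbf_none (zC C)) (@lbf_none _ z') -?cz //.
by case: lbf => [[[? ?] ?]|] //=; rewrite !ev_cat !content_cat ez cz.
Qed.

Variables (H : set finSemigroup) (HG : pseudovariety_of_groups H).

(** The quotient by the data stays in DRH.  Let [e] be an idempotent, the class
    of a word [w], and let [x] be R-related to [e], the class of a word [z].
    Then [w] and [z] have the same letters, and [x = e x] is the class of
    [w ++ z], whose data depends on [z] only through its content and its value
    in [T], by [lbf_data_absorb].  So the projection to [T] is injective on the
    R-class of [e], which inherits its group structure from an R-class of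
    [T]; the identity [x e = x] follows from the same identity in [T]. *)
Lemma lbf_test (a0 : A) : DRH H T ->
  exists (T' : finSemigroup) (t' : A -> T'), DRH H T' /\
    forall w w', ev t' w = ev t' w' -> w <> [::] -> lbf_data w = lbf_data w'.
Proof.
move=> TH.
have [T' [t' [gen' t'E]]] := word_quotient a0 lbf_data_congruence.
have t'P w w' : ev t' w = ev t' w' -> w <> [::] -> lbf_data w = lbf_data w'.
  move=> e wn; apply/t'E => // w'0; apply: wn.
  by move: e; rewrite w'0 => /ev_none.
exists T', t'; split=> //.
have fin : finer t' t.
  move=> w w' e; have [w0|wn] := pselect (w = [::]).
    by move: e; rewrite w0 => /esym/ev_none ->.
  by have [] := t'P _ _ e wn.
have [pi piE] := hom_of_finer gen' fin.
have piw w x : ev t' w = Some x -> ev t w = Some (pi x).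
  by move=> wx; rewrite -piE ev_hom wx.
apply: (DRH_intro HG) => e ee.
have pee : pi e * pi e = pi e by rewrite -gmulfM ee.
have [xpe [G [h [HGr hM hinj]]]] := DRH_chart HG TH pee.
have piR x : greenR e x -> greenR (pi e) (pi x).
  move=> /(greenR_idem _ ee)[ex [y xy]]; apply/(greenR_idem _ pee).
  by split; [rewrite -gmulfM ex|exists (pi y); rewrite -gmulfM xy].
have [w we] := gen' e.
have wn : w <> [::] by move=> w0; rewrite w0 in we.
have cont x z : greenR e x -> ev t' z = Some x -> content z = content w.
  move=> /(greenR_idem _ ee)[ex [y xy]] zx; have [z' zy] := gen' y.
  have zn : z <> [::] by move=> z0; rewrite z0 in zx.
  have catn (u v : seq A) : u <> [::] -> u ++ v <> [::] by case: u.
  have [_ wz _] : lbf_data (w ++ z) = lbf_data z.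
    by apply: t'P; [rewrite ev_cat we zx -[in RHS]ex|exact: catn].
  have [_ zw _] : lbf_data (z ++ z') = lbf_data w.
    by apply: t'P; [rewrite ev_cat we zx zy -xy|exact: catn].
  apply/eqP; rewrite finset.eqEsubset -{1}zw -{2}wz !content_cat.
  by rewrite finset.subsetUl finset.subsetUl.
(* On the R-class of [e], elements are determined by their image in [T]. *)
have absorb x y z z' : greenR e x -> ev t' z = Some x -> ev t' z' = Some y ->
    content z' = content w -> e * x = x -> pi x = pi y -> x = e * y.
  move=> xR zx zy cz' ex pxy; have cz := cont _ _ xR zx.
  have wzE : ev t' (w ++ z) = ev t' (w ++ z').
    apply/t'E; [by case: (w) wn|by case: (w) wn|].
    by apply: lbf_data_absorb; rewrite ?cz ?cz' // (piw _ _ zx) (piw _ _ zy) pxy.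
  by move: wzE; rewrite !ev_cat we zx zy => -[<-].
split=> [x xR|].
  have [z zx] := gen' x; have [ex _] := (greenR_idem _ ee).1 xR.
  rewrite -[in LHS]ex -mulgA; apply/esym.
  apply: (absorb _ _ z (z ++ w)) => //.
  - by rewrite ev_cat zx we.
  - by rewrite content_cat (cont _ _ xR zx) finset.setUid.
  - by rewrite gmulfM (xpe _ (piR _ xR)).
exists G, (h \o pi); split=> //= [x y xR yR|x y xR yR].
  by rewrite gmulfM hM //; exact: piR.
move=> /(hinj _ _ (piR _ xR) (piR _ yR)) pxy.
have [z zx] := gen' x; have [z' zy] := gen' y.
have [ex _] := (greenR_idem _ ee).1 xR; have [ey _] := (greenR_idem _ ee).1 yR.
by rewrite (absorb x y z z') // (cont _ _ yR).
Qed.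
End Data.

End LeftBasicFactorization.

(** * Non-explicit operations and regular elements of DRH *)

Lemma ev_word (A : finType) (T : finSemigroup) (t : A -> T) a w :
  ev t (a :: w) = Some (val_at t (word a w)).
Proof.
rewrite /word -[ev t _]/((Some (val_at t (gen a)) : T^I) * ev t w).
elim: w (gen a) => [|b w IH] u /=; first by rewrite mulg1.
by rewrite -IH mulgA.
Qed.

(** The words of length at most [k], with the longer ones identified, form a
    finite quotient of the free semigroup.  If the value of [p] there were a
    short word, every word approximating [p] finely enough would be that very
    word, and [p] would be explicit. *)
Lemma nonexplicit_long n (p : pseudoword 'I_n) : ~ explicit_op p ->
  forall (T : finSemigroup) (t : 'I_n -> T) (k : nat),
  exists2 w, (k < size w)%N & ev t w = Some (val_at t p).
Proof.
move=> nexp T t k; have [a0 _] := pseudoword_letter p.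
pose short w : option (k.-bseq 'I_n) := insub w.
have shortE w w' : short w = short w' -> (size w <= k)%N -> w = w'.
  move=> e wk; move: e; rewrite /short insubT; case: insubP => // u _ <- [].
  by move=> <-.
have short_long w : (k < size w)%N -> short w = None.
  by move=> kw; rewrite /short insubF // leqNgt kw.
have longC w w' z z' : (k < size w)%N || (k < size z)%N ->
    short w = short w' -> short z = short z' -> (k < size w' + size z')%N.
  move=> l sw sz; have lw := short_long w; have lz := short_long z.
  case/orP: l => [/[dup] /lw e kw|/[dup] /lz e kz].
    rewrite (leq_trans _ (leq_addr _ _)) // ltnNge; apply/negP => w'k.
    by move: (shortE w' w); rewrite -sw => /(_ erefl w'k) e'; rewrite e' leqNgt kw in w'k.
  rewrite (leq_trans _ (leq_addl _ _)) // ltnNge; apply/negP => z'k.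
  by move: (shortE z' z); rewrite -sz => /(_ erefl z'k) e'; rewrite e' leqNgt kz in z'k.
have shortC : word_congruence short.
  move=> w w' z z' sw sz; have [l|/norP[]] := boolP ((k < size w)%N || (k < size z)%N).
    rewrite !short_long // size_cat ?(longC w w' z z') //.
    by case/orP: l => l; [exact: leq_trans l (leq_addr _ _)|exact: leq_trans l (leq_addl _ _)].
  by rewrite -!leqNgt => /(shortE _ _ sw) -> /(shortE _ _ sz) ->.
have [Q [q [genq qE]]] := word_quotient a0 shortC.
have [w0 w0E] := genq (val_at q p).
have w0n : w0 <> [::] by move=> e; rewrite e in w0E.
have dense (T' : finSemigroup) (t' : 'I_n -> T') :
    exists2 w, short w = short w0 & ev t' w = Some (val_at t' p).
  have [w [wt wq]] := valI_dense2 t' q (Some p).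
  exists w => //; apply/qE => //; first by move=> e; rewrite e in wq.
  by rewrite wq w0E.
have [w0k|kw0] := leqP (size w0) k.
  case: nexp; case: w0 w0n w0E w0k dense => // a w _ _ wk dense; exists a, w.
  apply: val_at_inj => T' t'; have [w' /esym/shortE w'E] := dense _ t'.
  by rewrite -w'E // ev_word => -[].
have [w sw wE] := dense _ t; exists w => //; rewrite ltnNge; apply/negP => wk.
by move: (wk); rewrite (shortE _ _ sw wk) leqNgt kw0.
Qed.

Lemma ev_const (A : Type) (T : semigroupType) (c : T) (w : seq A) :
  ev (fun=> c) w = (Some c : T^I) ^+ size w.
Proof. by elim: w => //= a w ->; rewrite expgS. Qed.

Lemma expg_some (T : semigroupType) (c : T) m : (0 < m)%N ->
  exists d, (Some c : T^I) ^+ m = Some d.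
Proof.
case: m => // m _; rewrite -(size_nseq m.+1 tt) -ev_const.
by apply: ev_some.
Qed.

(** The powers of [c] are ultimately periodic, and the exponent [m] is beyond
    the index; a multiple of the period that exceeds [m] provides the
    pseudo-inverse. *)
Lemma expg_regular (T : finSemigroup) (c d : T) m : (#|{: option T}| < m)%N ->
  (Some c : T^I) ^+ m = Some d -> regular d.
Proof.
move=> cm dE; set y : T^I := Some c in dE.
have [i [j [ij jm yij]]] : exists i j, [/\ (i < j)%N, (j < m)%N & y ^+ i = y ^+ j].
  pose f (i : 'I_m) : option T := y ^+ i.
  have : ~~ injectiveb f.
    apply/injectiveP => /leq_card; rewrite card_ord leqNgt.
    by rewrite (cm).
  move=> /injectivePn[i [j nij fij]].
  case: (ltngtP i j) => ij; first by exists i, j.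
    by exists j, i.
  by rewrite (val_inj ij) eqxx in nij.
have per k : (i <= k)%N -> y ^+ k = y ^+ (k + (j - i)).
  move=> ik; rewrite -{1}(subnK ik) expgnDr yij -expgnDr; congr (_ ^+ _).
  by rewrite addnBA ?(ltnW ij) // -addnBAC.
have pern k l : (i <= k)%N -> y ^+ k = y ^+ (k + l * (j - i)).
  move=> ik; elim: l => [|l IH]; first by rewrite addn0.
  by rewrite IH per ?(leq_trans ik) ?leq_addr // mulSn addnA addnAC.
have im : (i <= m)%N by apply: ltnW; exact: ltn_trans jm.
have mle : (m < m.+1 * (j - i))%N by rewrite leq_pmulr // subn_gt0.
have lpos : (0 < m.+1 * (j - i) - m)%N by rewrite subn_gt0.
have [z zE] := expg_some c lpos.
exists z.
(* Here [m.+1 * (j - i)] is the multiple of the period in use. *)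
have : y ^+ m * y ^+ (m.+1 * (j - i) - m) * y ^+ m = y ^+ m.
  rewrite -!expgnDr [in RHS](pern _ m.+1 im); congr (_ ^+ _).
  by rewrite subnKC 1?ltnW // addnC.
by rewrite dE zE => -[].
Qed.

Section Absorb.
Variables (A : finType) (H : set finSemigroup) (HG : pseudovariety_of_groups H).

(** Let [e] be an idempotent in the R-class of [f].  That R-class is a group of
    H with identity [e].  For a prefix [x a] of [W], both [e x] and [e x a] lie
    between [e] and [f], hence in this group, and cancelling [e x] shows that
    [e a] lies in it too.  Since [e] is also a right identity there, [e r] is
    the product in the group of the elements [e a], over the letters [a] of
    [r]; finally [f r = f e r]. *)
Lemma DRH_absorb (T : finSemigroup) (t : A -> T) (W : seq A) (f : T) :
  DRH H T -> ev t W = Some f -> regular f ->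
  exists (G : finSemigroup) (t' : A -> G) (g : {multiplicative G -> T}), H G /\
    forall r, r <> [::] -> content r \subset content W ->
      (Some f : T^I) * ev t r = (Some f : T^I) * omap g (ev t' r).
Proof.
move=> TH We [z fzf]; set e := f * z.
have ee : e * e = e by rewrite /e mulgA fzf.
have [G [g [h [HGr ginj gP hK]]]] := DRH_elim TH ee.
have [xe _] := DRH_chart HG TH ee.
have eR : greenR e e by apply/(greenR_idem _ ee); split=> //; exists e.
have fR : greenR e f by apply/(greenR_regular _ fzf); split; left.
have ef : e * f = f by [].
have prefix x u v : (Some e : T^I) * ev t u = Some x -> (Some x : T^I) * ev t v = Some f ->
    greenR e x.
  move=> xE xv; apply/(greenR_idem _ ee); split.
    have : (Some e : T^I) * Some x = Some x by rewrite -xE mulgA someM ee.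
    by case.
  case: (ev t v) xv => [v' [xv]|[xf]]; last by exists z; rewrite xf.
  by exists (v' * z); rewrite mulgA xv.
have [u u1 uinv] := HG.2 _ HGr.
have gu : g u = e.
  have [y ye] := (gP e).1 eR; have [y' [_ y'y]] := uinv y.
  have yy : y * y = y by apply: ginj; rewrite gmulfM ye ee.
  have yu : y = u by rewrite -y'y -{2}yy mulgA y'y (u1 y).1.
  by rewrite -yu.
have letter a : a \in content W -> greenR e (e * t a).
  rewrite in_content => /splitPr WE; case: {W} _ / WE We => x y.
  rewrite ev_cat => We.
  have [ex exE] : exists ex, (Some e : T^I) * ev t x = Some ex.
    by case: (ev t x) => [x'|]; eexists.
  have eW : (Some ex : T^I) * ev t (a :: y) = Some f by rewrite -exE -mulgA We someM ef.
  have exR := prefix _ _ _ exE eW.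
  have exaR : greenR e (ex * t a).
    apply: (prefix _ (x ++ [:: a]) y); first by rewrite ev_cat mulgA exE.
    by rewrite -eW /= mulgA.
  have [x' x'E] := (gP _).1 exR; have [x'' x''E] := (gP _).1 exaR.
  have [k [_ kx]] := uinv x'.
  apply/gP; exists (k * x''); rewrite gmulfM x''E.
  by rewrite -(xe _ exR) -[ex * e * t a]mulgA -x'E [LHS]mulgA -gmulfM kx gu mulgA ee.
exists G, (fun a => h (e * t a)), g; split=> // r rn rW.
rewrite -{1}(xe _ fR) -someM -mulgA; congr (_ * _).
elim: r rn rW => // a r IH _; rewrite content_cons finset.subUset finset.sub1set => /andP[aW rW].
have [->|rn] := pselect (r = [::]).
  by rewrite !ev1 someM /= hK //; exact: letter.
have {}IH := IH rn rW.
rewrite /= mulgA someM -{1}(xe _ (letter _ aW)) -someM -mulgA IH.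
have [x xE] := ev_some (fun a => h (e * t a)) rn.
by rewrite xE !someM /= gmulfM hK //; exact: letter.
Qed.

End Absorb.

(** * The topology of pseudowords and continuous homomorphisms *)

Section Topology.
Variable A : finType.

(** By taking products of tests, one test is enough to describe a basic
    neighbourhood. *)
Definition test_nbhs (v : pseudoword A) : set_system (pseudoword A) :=
  [set O | exists (T : finSemigroup) (t : A -> T), forall u, val_at t u = val_at t v -> O u].

Lemma val_at_prod (S T : finSemigroup) (s : A -> S) (t : A -> T) (u v : pseudoword A) :
  let st := fun a => prod_enc (s a, t a) in
  val_at st u = val_at st v -> val_at s u = val_at s v /\ val_at t u = val_at t v.
Proof.
move=> st e; have [fs ft] := finer_prod s t.
have [w [ws wt wst]] := valI_dense3 s t st (Some u).
have [z [zs zt zst]] := valI_dense3 s t st (Some v).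
have ez : ev st w = ev st z by rewrite wst zst /= e.
have := fs _ _ ez; have := ft _ _ ez; rewrite ws zs wt zt /=.
by move=> [->] [->].
Qed.

Global Instance test_nbhs_filter v : Filter (test_nbhs v).
Proof.
split; first by exists trivial_table, (fun=> ord0).
  move=> O P [S [s sO]] [T' [t tP]].
  exists (prod_table S T'), (fun a => prod_enc (s a, t a)) => u.
  by move=> /val_at_prod [/sO ? /tP ?].
by move=> O P OP [S [s sO]]; exists S, s => u /sO/OP.
Qed.

Lemma open_test (O : set (pseudoword A)) v : open O -> O v -> test_nbhs v O.
Proof.
move=> [B oB <-] Bv.
have cv : (@eval_all pvS A) @ test_nbhs v --> eval_all v.
  apply/cvg_sup => i W; rewrite nbhsE /= => -[_ [[D oD <-] Di] DW].
  case: i D oD Di DW => -[S []] s D oD Di DW.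
  by exists S, s => u uv; apply: DW; rewrite /= -[eval_all u _]/(val_at s u) uv.
exact/cv/open_nbhs_nbhs.
Qed.

Lemma test_open (O : set (pseudoword A)) :
  (forall v, O v -> test_nbhs v O) -> open O.
Proof.
rewrite openE => tO v /tO [T [t tE]].
pose i : {S : {S : finSemigroup | pvS S} & A -> sval S} :=
  existT (fun S : {S : finSemigroup | pvS S} => A -> sval S) (in_pvS T) t.
have nv : nbhs (eval_all v) [set f | f i = eval_all v i].
  have /cvg_sup/(_ i) : nbhs (eval_all v) --> eval_all v by [].
  move=> /(_ [set f | f i = eval_all v i]); apply.
  rewrite nbhsE /=; exists [set f | f i = eval_all v i] => //; split=> //.
  by exists [set eval_all v i]; [exact: discrete_open|].
have nO : nbhs v (@eval_all pvS A @^-1` [set f | f i = eval_all v i]).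
  exact: (@initial_continuous _ _ (@eval_all pvS A) v _ nv).
rewrite /interior /mkset; apply: filterS nO => u; exact: tE.
Qed.
End Topology.

Lemma valI_inj (A : finType) (u v : (pseudoword A)^I) :
  (forall (T : finSemigroup) (t : A -> T), valI t u = valI t v) -> u = v.
Proof.
case: u v => [u|] [v|] uv //; last 2 first.
- by have := uv trivial_table (fun=> ord0).
- by have := uv trivial_table (fun=> ord0).
by congr Some; apply: val_at_inj => S s; have [] := uv S s.
Qed.

Section Extension.
Variables (X A : finType) (f : X -> (pseudoword A)^I).

(** The monoid [T^I] as a table, so that pseudowords can be evaluated in it. *)
Definition adj_table (T : finSemigroup) : finSemigroup :=
  table (F := option T) (@adj_mulA T) None.
Definition adj_enc (T : finSemigroup) (x : T^I) : adj_table T :=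
  table_enc (None : option T) x.
Definition adj_dec (T : finSemigroup) (x : adj_table T) : T^I :=
  table_dec (None : option T) x.

Lemma adj_decM (T : finSemigroup) (x y : adj_table T) : adj_dec (x * y) = adj_dec x * adj_dec y.
Proof. exact: table_decM. Qed.

(** The value under [t] of the image of [u] by the homomorphism that extends
    [f]: evaluate [u] in [T^I] at the values of the [f x]. *)
Definition subst_val (T : finSemigroup) (t : A -> T) (u : pseudoword X) : T^I :=
  adj_dec (val_at (fun x => adj_enc (valI t (f x))) u).

Lemma subst_valM (T : finSemigroup) (t : A -> T) (u v : pseudoword X) :
  subst_val t (u * v) = subst_val t u * subst_val t v.
Proof. by rewrite /subst_val -adj_decM. Qed.

Lemma subst_val_gen (T : finSemigroup) (t : A -> T) x :
  subst_val t (gen x) = valI t (f x).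
Proof. exact: table_encK. Qed.

Definition subst_word (w : seq X) : (pseudoword A)^I := foldr (fun x u => f x * u) 1 w.

Lemma subst_val_dense (S T : finSemigroup) (s : A -> S) (t : A -> T) (u : pseudoword X) :
  exists w, subst_val s u = valI s (subst_word w) /\ subst_val t u = valI t (subst_word w).
Proof.
have wordE (R : finSemigroup) (r : A -> R) w :
    obind (@adj_dec R) (ev (fun x => adj_enc (valI r (f x))) w) = valI r (subst_word w).
  elim: w => //= x w; rewrite valIM => <-.
  case: (ev _ w) => [y|]; first by rewrite someM /= adj_decM [adj_dec (adj_enc _)]table_encK.
  by rewrite !mulg1 /=; exact: table_encK.
have [w [ws wt]] := valI_dense2 (fun x => adj_enc (valI s (f x)))
  (fun x => adj_enc (valI t (f x))) (Some u).
by exists w; rewrite -!wordE ws wt.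
Qed.

Lemma subst_val_hom (S T : finSemigroup) (h : {multiplicative S -> T}) (s : A -> S) u :
  subst_val (h \o s) u = omap h (subst_val s u).
Proof.
have [w [-> ->]] := subst_val_dense (h \o s) s u.
by case: (subst_word w) => //= v; rewrite val_at_hom.
Qed.

(** The values [subst_val t u] are compatible with homomorphisms, and whether
    they equal [None] is the same for all [t], since they are simultaneously
    the values of the image of one word over [X].  They are thus the values of
    an element of [(pseudoword A)^I].  Continuity holds because the value of
    the image under one test depends on the value of [u] under one test. *)
Lemma extension : exists delta : {multiplicative pseudoword X -> (pseudoword A)^I},
  continuous delta /\ forall x, delta (gen x) = f x.
Proof.
(* The pseudoword [v0] provides natural default values in each semigroup; if
   there is none, [f] can only take the value [None]. *)
have [[v0 _]|nv] := pselect (exists v : pseudoword A, True); last first.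
  have cM : {morph (fun _ : pseudoword X => None : (pseudoword A)^I) : u v / u * v} by [].
  exists (mk_hom cM); split; first exact: cst_continuous.
  by move=> x /=; case: (f x) => // v; case: nv; exists v.
have nat u (S T : {S : finSemigroup | pvS S}) (h : {multiplicative sval S -> sval T})
    (s : A -> sval S) :
    odflt (val_at (h \o s) v0) (subst_val (h \o s) u) = h (odflt (val_at s v0) (subst_val s u)).
  by rewrite subst_val_hom val_at_hom; case: subst_val.
pose t0 (a : A) : trivial_table := ord0.
pose delta u : (pseudoword A)^I :=
  if subst_val t0 u is Some _ then Some (FreePro (nat u)) else None.
have deltaE (T : finSemigroup) (t : A -> T) u : valI t (delta u) = subst_val t u.
  have [w [w0 wt]] := subst_val_dense t0 t u; rewrite /delta w0.
  case: (subst_word w) wt => [v|] /= wt; last by rewrite wt.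
  by rewrite wt.
have deltaM : {morph delta : u v / u * v}.
  by move=> u v; apply: valI_inj => T t; rewrite valIM !deltaE subst_valM.
exists (mk_hom deltaM); split; last first.
  by move=> x; apply: valI_inj => T t; rewrite /= deltaE subst_val_gen.
apply/continuousP => U oU; apply: test_open => u /=.
have same (T : finSemigroup) (t : A -> T) u' :
    val_at (fun x => adj_enc (valI t (f x))) u' = val_at (fun x => adj_enc (valI t (f x))) u ->
    valI t (delta u') = valI t (delta u).
  by rewrite !deltaE /subst_val => ->.
case du : (delta u) => [v|] Uv.
  have [T [t tU]] := open_test (oU : open [set x | U (Some x)]) Uv.
  exists (adj_table T), (fun x => adj_enc (valI t (f x))) => u' /same.
  by rewrite du /preimage /=; case: (delta u') => //= v' [] /tU.
exists (adj_table trivial_table), (fun x => adj_enc (valI t0 (f x))) => u' /same.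
by rewrite du /preimage /= => /valI_none ->.
Qed.

End Extension.

(** * Compactness arguments and pointlike tuples *)

Lemma common_refinement (A Q : finType) (V : set finSemigroup)
    (tau : Q -> {T : finSemigroup & A -> T}) :
  V !=set0 -> (forall S T, V S -> V T -> V (prod_table S T)) ->
  (forall q, V (tag (tau q))) ->
  exists (T : finSemigroup) (t : A -> T), V T /\ forall q, finer t (tagged (tau q)).
Proof.
move=> [T0 V0] Vprod tauV.
suff : forall l : seq Q, exists (T : finSemigroup) (t : A -> T),
    V T /\ forall q, q \in l -> finer t (tagged (tau q)).
  move=> /(_ (enum Q)) [T [t [VT tP]]]; exists T, t; split=> // q.
  by apply: tP; rewrite mem_enum.
elim=> [|q l [T [t [VT tl]]]]; first by exists T0, (fun=> ord0).
have [f1 f2] := finer_prod t (tagged (tau q)).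
exists (prod_table T (tag (tau q))), (fun a => prod_enc (t a, tagged (tau q) a)).
split; first exact: Vprod.
by move=> q'; rewrite inE => /orP[/eqP ->|/tl q't] //; exact: finer_trans q't.
Qed.

(** If each of the finitely many [q] failed for some test, all of them would
    fail for a common refinement of these tests. *)
Lemma uniform_choice (A Q : finType) (V : set finSemigroup)
    (R : forall T : finSemigroup, (A -> T) -> Q -> Prop) :
  V !=set0 -> (forall S T, V S -> V T -> V (prod_table S T)) ->
  (forall (S T : finSemigroup) (s : A -> S) (t : A -> T) q, finer s t -> R S s q -> R T t q) ->
  (forall (T : finSemigroup) (t : A -> T), V T -> exists q, R T t q) ->
  exists q, forall (T : finSemigroup) (t : A -> T), V T -> R T t q.
Proof.
move=> V0 Vprod Rfin VR; apply: contrapT => nq.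
have /choice[bad badP] (q : Q) : exists Tt : {T : finSemigroup & A -> T},
    V (tag Tt) /\ ~ R (tag Tt) (tagged Tt) q.
  apply: contrapT => nbad; apply: nq; exists q => T t VT.
  by apply: contrapT => nR; apply: nbad; exists (existT _ T t).
have [T [t [VT tbad]]] := common_refinement V0 Vprod (fun q => (badP q).1).
have [q qR] := VR T t VT; have [_ []] := badP q.
exact: Rfin (tbad q) qR.
Qed.

(** A sequence in which each term is related to all later ones must repeat a
    value. *)
Lemma finite_cycle (F : finType) (D : F -> Prop) (E : F -> F -> Prop) :
  (forall x y z, E x y -> E y z -> E x z) ->
  (forall x, D x -> exists y, D y /\ E x y) -> forall x, D x -> exists y, D y /\ E y y.
Proof.
move=> Et DE x Dx.
have /choice[nxt nxtP] (y : F) : exists z, D y -> D z /\ E y z.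
  have [/DE[z zP]|nD] := pselect (D y); [by exists z|by exists y => /nD].
pose u i := iter i nxt x.
have uD i : D (u i) by elim: i => //= i /nxtP[].
have uE i j : E (u i) (u (j.+1 + i)%N).
  elim: j => [|j IH]; first by have [] := nxtP _ (uD i).
  by apply: Et IH _; have [] := nxtP _ (uD (j.+1 + i)%N).
have : ~~ injectiveb (fun i : 'I_#|F|.+1 => u i).
  by apply/injectiveP => /leq_card; rewrite card_ord ltnn.
move=> /injectivePn[i [j nij uij]].
wlog ij : i j nij uij / (i < j)%N.
  move=> W; case: (ltngtP i j) => ij; first exact: W ij.
    by apply: W (esym uij) ij; rewrite eq_sym.
  by rewrite (val_inj ij) eqxx in nij.
exists (u i); split=> //; have := uE i (j - i).-1.
by rewrite prednK ?subn_gt0 // subnK ?(ltnW ij) // -uij.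
Qed.

Lemma eq_mod_some (V : set finSemigroup) (A : finType) (u v : pseudoword A) :
  eq_mod V (Some u) (Some v) <->
  forall (T : finSemigroup) (t : A -> T), V T -> val_at t u = val_at t v.
Proof.
split=> [uv T t VT|uv].
  by have [] := congr1 (omap (fun w : free_pro V A => @op_at V A w (exist _ T VT) t)) uv.
by congr Some; apply: free_pro_eq => S s; exact: (uv _ s (svalP S)).
Qed.

Lemma clopen_valI (A : finType) (P : finSemigroup) (phi : A -> P) (Y : set (P^I)) :
  clopen [set v | Y (valI phi v)].
Proof.
have opn (Z : set (P^I)) : open [set v : (pseudoword A)^I | Z (valI phi v)].
  change (open [set x : pseudoword A | Z (Some (val_at phi x))]).
  by apply: test_open => v Zv; exists P, phi => u; rewrite /mkset => ->.
split; first exact: opn.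
by rewrite -openC; exact: (opn (~` Y)).
Qed.

Lemma chain_all_eq (X : finType) (C : Type) (r : pseudoword X -> C) (s : seq X) :
  (forall e, e \in pointlike_chain s -> r e.1 = r e.2) ->
  forall x y, x \in s -> y \in s -> r (gen x) = r (gen y).
Proof.
move=> rE; suff hd : forall z s', s = z :: s' -> forall x, x \in s -> r (gen x) = r (gen z).
  by case: s rE hd => // z s' _ hd x y xs ys; rewrite (hd _ _ erefl x) // (hd _ _ erefl y).
elim: s rE => // z s IH rE _ _ [<- _] x; rewrite inE => /orP[/eqP-> //|].
case: s IH rE => // z' s IH rE.
have zz' : r (gen z) = r (gen z') by apply: (rE (gen z, gen z')); rewrite inE eqxx.
rewrite zz'; apply: IH => // e es; apply: rE.
by rewrite inE es orbT.
Qed.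

Section Pointlike.
Variables (A X : finType) (P : finSemigroup) (phi : A -> P).

(** The entries of [s] form a V-pointlike set; by density it is enough to
    consider words. *)
Definition pointlike (V : set finSemigroup) (s : X -> P^I) :=
  forall (T : finSemigroup) (t : A -> T), V T -> exists w : X -> seq A,
    (forall x, ev phi (w x) = s x) /\ forall x y, ev t (w x) = ev t (w y).

(** Words chosen for all tests in [V] converge along an ultrafilter that contains,
    for each test, the set of its refinements; so each test in [V] eventually
    identifies the chosen words. *)
Lemma pointlike_limit (V : set finSemigroup) (s : X -> P^I) :
  V !=set0 -> (forall S T, V S -> V T -> V (prod_table S T)) ->
  pointlike V s -> (forall x, s x <> None) ->
  exists u : X -> pseudoword A, (forall x, Some (val_at phi (u x)) = s x) /\
    forall (T : finSemigroup) (t : A -> T), V T -> forall x y, val_at t (u x) = val_at t (u y).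
Proof.
move=> [T0 V0] Vprod spt sn.
pose J := {Tt : {T : finSemigroup & A -> T} | V (tag Tt)}.
have /choice[w wP] (j : J) : exists w : X -> seq A, (forall x, ev phi (w x) = s x) /\
    forall x y, ev (tagged (sval j)) (w x) = ev (tagged (sval j)) (w y).
  by case: j => -[T t] VT; exact: spt.
pose Up (j : J) : set J := [set j' | finer (tagged (sval j')) (tagged (sval j))].
pose F : set_system J := filter_from setT Up.
have FF : ProperFilter F.
  apply: filter_from_proper; last by move=> j _; exists j.
  apply: filter_from_filter; first by exists (exist _ (existT _ T0 (fun=> ord0)) V0).
  move=> [[S s'] VS] [[T t] VT] _ _.
  have [fs ft] := finer_prod s' t.
  exists (exist _ (existT _ (prod_table S T) (fun a => prod_enc (s' a, t a))) (Vprod _ _ VS VT)) => //.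
  by move=> [[R r] VR] /= rst; split=> /=; [exact: finer_trans fs|exact: finer_trans ft].
have [U [UU FU]] := ultraFilterLemma FF.
have wn x j : w j x <> [::].
  by move=> wx; apply: (sn x); have [<- _] := wP j; rewrite wx.
have /choice[u uP] x := pseudoword_limit UU (wn x).
exists u; split=> [x|T t VT x y].
  case sx : (s x) (sn x) => [c|] // _; congr Some; apply: uP.
  by apply: filterS filterT => j _ /=; have [-> _] := wP j.
pose j : J := exist _ (existT _ T t) VT.
have Uj : U (Up j) by apply: FU; exists j.
have [c Uc] : exists c, U [set j | ev t (w j x) = c].
  by apply: (ultra_finite (F := option T)).
case: c Uc => [c|] Uc; last by have /filter_ex[k /= /ev_none /wn] := Uc.
rewrite (uP x _ _ _ Uc); apply/esym/uP; apply: filterS2 Uj Uc => k /= kj <-.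
by apply: kj; have [_] := wP k; apply.
Qed.

End Pointlike.

(** * Pointlike tuples are realized by sigma-words *)

Lemma ev_power (A : finType) (T : semigroupType) (t : A -> T) w n :
  ev t (flatten (nseq n w)) = ev t w ^+ n.
Proof. by elim: n => //= n IH; rewrite ev_cat IH expgS. Qed.

Lemma content_power (A : finType) (w : seq A) n : (0 < n)%N ->
  content (flatten (nseq n w)) = content w.
Proof.
case: n => // n _; elim: n => [|n IH]; first by rewrite /= cats0.
by rewrite [nseq _ _]/= [flatten _]/= content_cat IH finset.setUid.
Qed.

Section Realization.
Variables (sigma : op_set) (H : set finSemigroup).
Hypothesis sigma_sig : implicit_signature sigma.
Hypothesis sigma_nonexplicit :
  exists (n : nat) (p : pseudoword 'I_n), @sigma n p /\ ~ explicit_op p.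
Hypothesis HG : pseudovariety_of_groups H.
Hypothesis H_reducible : reducible sigma H pointlike_systems.
Variables (A X : finType) (x0 : X) (P : finSemigroup) (phi : A -> P) (cont : P^I -> {set A}).
Hypothesis contE : forall w, cont (ev phi w) = content w.

(** The equalities are those modulo DRH, expressed through values in members of
    DRH. *)
Definition realized (s : X -> P^I) := exists v : X -> (pseudoword A)^I,
  [/\ forall x, sigma_wordI sigma (v x), forall x, valI phi (v x) = s x &
      forall (T : finSemigroup) (t : A -> T), DRH H T ->
        forall x y, valI t (v x) = valI t (v y)].

Lemma realized_mul s s' : realized s -> realized s' -> realized (fun x => s x * s' x).
Proof.
move=> [v [vs vphi vT]] [v' [vs' vphi' vT']]; exists (fun x => v x * v' x); split.
- by move=> x; exact: sigma_wordI_mul.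
- by move=> x; rewrite valIM vphi vphi'.
- by move=> T t TH x y; rewrite !valIM (vT T t TH x y) (vT' T t TH x y).
Qed.

Lemma realized_letter a : realized (fun=> Some (phi a)).
Proof. by exists (fun=> Some (gen a)); split=> // x; exact: SigmaGen. Qed.

Lemma cont_valI v s : valI phi v = s -> cont s <> finset.set0 -> v <> None.
Proof. by move=> <- cn v0; apply: cn; rewrite v0 (contE [::]) content_nil. Qed.

(** Reducibility of H, applied to the single chain that equates all variables.
    The constraints include the content, through [phi], so that the sigma-words
    obtained are nonempty. *)
Lemma realized_group (s : X -> P^I) (B : {set A}) : B <> finset.set0 ->
  pointlike phi H s -> (forall x, cont (s x) = B) ->
  exists v : X -> (pseudoword A)^I,
  [/\ forall x, sigma_wordI sigma (v x), forall x, valI phi (v x) = s x &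
      forall (T : finSemigroup) (t : A -> T), H T ->
        forall x y, valI t (v x) = valI t (v y)].
Proof.
move=> Bn spt sB.
have sn x : s x <> None.
  by move=> sx; apply: Bn; rewrite -(sB x) sx (contE [::]) content_nil.
have Hprod S T : H S -> H T -> H (prod_table S T) by exact: (prod_table_in HG.1).
have [u [us uT]] := pointlike_limit (pv_nonempty HG.1) Hprod spt sn.
pose E := pointlike_chain (enum X).
pose K x := [set v : (pseudoword A)^I | valI phi v = s x].
have [d [dc dE]] := extension (fun x => Some (u x)).
have dsol : solution H E K d.
  split=> // [e|x]; last by rewrite /K dE /mkset -us.
  move=> /mapP[[x y] _ ->]; rewrite /= !dE; apply/eq_mod_some => T t TH; exact: uT.
have [|||d' [_ d'E d'K] d's] := H_reducible (X := X) (A := A) (E := E) (K := K).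
- by exists [:: enum X] => //=; rewrite cats0.
- by move=> x; exact: (clopen_valI phi (fun z => z = s x)).
- by exists d.
exists (fun x => d' (gen x)); split=> // T t TH x y.
have := chain_all_eq (r := fun u => rhoI H (d' u)) d'E.
move=> /(_ x y); rewrite !mem_enum => /(_ isT isT) /=.
have dn z : d' (gen z) <> None by apply: cont_valI (d'K z) _; rewrite sB.
case: (d' (gen x)) (dn x) => // v _; case: (d' (gen y)) (dn y) => // v' _ vv'.
by congr Some; have /eq_mod_some := vv'; apply.
Qed.

(** Sigma-words for [s] that are equal only modulo H become equal modulo DRH
    after multiplication on the left by a large power of sigma-words for [q],
    which is regular and contains all their letters; by the hypothesis on [s]
    this multiplication does not change the values under [phi]. *)
Lemma realized_absorb (q s : X -> P^I) (B : {set A}) : B <> finset.set0 ->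
  realized q -> (forall x, cont (q x) = B) ->
  pointlike phi (DRH H) s -> (forall x, cont (s x) = B) ->
  (forall x, s x = q x * s x) -> realized s.
Proof.
move=> Bn [v [vs vphi vT]] qB spt sB sq.
have sptH : pointlike phi H s by move=> T t TH; apply: spt; exact: DRH_group.
have [r [rs rphi rT]] := realized_group Bn sptH sB.
have [n [p [sp np]]] := sigma_nonexplicit.
have /choice[y yE] x : exists y, v x = Some y.
  have : v x <> None by apply: cont_valI (vphi x) _; rewrite qB.
  by case: (v x) => // y _; exists y.
have ys x : sigma_word sigma (y x) by have := vs x; rewrite yE.
pose yp x : (pseudoword A)^I := Some (act p (fun=> y x)).
have ypE (T : finSemigroup) (t : A -> T) x :
    valI t (yp x) = Some (val_at (fun=> val_at t (y x)) p) by [].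
exists (fun x => yp x * r x); split.
- by move=> x; apply: sigma_wordI_mul => //; exact: SigmaOp.
- move=> x; rewrite valIM rphi ypE.
  have [W _ WE] := nonexplicit_long np (fun=> val_at phi (y x)) 0.
  rewrite -WE ev_const; have -> : Some (val_at phi (y x)) = q x by rewrite -vphi yE.
  by elim: (size W) => [|k IH]; rewrite ?mul1g // expgS -mulgA IH -sq.
move=> T t TH.
pose c := val_at t (y x0).
have yc x : val_at t (y x) = c.
  by have := vT T t TH x x0; rewrite !yE => -[].
have [W Wlong WE] := nonexplicit_long np (fun=> c) #|{: option T}|.
have W0 : (0 < size W)%N by exact: leq_ltn_trans Wlong.
set d := val_at _ p in WE.
have ypd x : valI t (yp x) = Some d by rewrite ypE yc.
have dreg : regular d by apply: (@expg_regular _ c d _ Wlong); rewrite -ev_const.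
have [w [wt wphi]] := valI_dense2 t phi (v x0).
have wB : content w = B by rewrite -contE wphi vphi qB.
have wd : ev t (flatten (nseq (size W) w)) = Some d.
  by rewrite ev_power wt yE -WE ev_const.
have [G [t' [g [HGr gE]]]] := DRH_absorb HG TH wd dreg.
have rE x : (Some d : T^I) * valI t (r x) = (Some d : T^I) * omap g (valI t' (r x)).
  have [z [zt zt' zphi]] := valI_dense3 t t' phi (r x).
  have zB : content z = B by rewrite -contE zphi rphi sB.
  rewrite -zt -zt'; apply: gE; last by rewrite zB content_power // wB.
  by move=> z0; apply: Bn; rewrite -zB z0 content_nil.
by move=> x x'; rewrite !valIM !ypd !rE (rT G t' HGr x x').
Qed.

(** For each test in DRH, apply the hypothesis to the finer test that sees left
    basic factorizations: the words obtained share their last new letter, and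
    their factors are identified by the given test.  The letter and the
    [phi]-values of the factors range over a finite set, so one choice of them
    serves all tests. *)
Lemma pointlike_step (s : X -> P^I) (B : {set A}) : B <> finset.set0 ->
  pointlike phi (DRH H) s -> (forall x, cont (s x) = B) ->
  exists a (s0 s1 : X -> P^I),
  [/\ a \in B, forall x, s x = s0 x * (Some (phi a) : P^I) * s1 x,
      pointlike phi (DRH H) s0 /\ pointlike phi (DRH H) s1,
      forall x, cont (s0 x) = (B :\ a)%SET &
      exists2 B1 : {set A}, B1 \subset B & forall x, cont (s1 x) = B1].
Proof.
move=> Bn spt sB.
have [a0 _] : exists a0, a0 \in B by apply/finset.set0Pn/eqP.
pose R (T : finSemigroup) (t : A -> T) (q : A * {ffun X -> option P} * {ffun X -> option P}) :=
  exists w0 w1 : X -> seq A,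
  [/\ [/\ q.1.1 \in B, forall x, ev phi (w0 x) = q.1.2 x & forall x, ev phi (w1 x) = q.2 x],
      forall x, s x = ev phi (w0 x ++ q.1.1 :: w1 x),
      forall x, content (w0 x) = (B :\ q.1.1)%SET /\ content (w1 x) \subset B,
      forall x y, content (w1 x) = content (w1 y) &
      forall x y, ev t (w0 x) = ev t (w0 y) /\ ev t (w1 x) = ev t (w1 y)].
have [[[a s0] s1] qR] : exists q, forall (T : finSemigroup) (t : A -> T), DRH H T -> R T t q.
  apply: uniform_choice; [by exists trivial_table; exact: DRH_trivial|exact: DRH_prod| |].
    move=> S T s' t q fin [w0 [w1 [h1 h2 h3 h4 h5]]]; exists w0, w1; split=> // x y.
    by have [e0 e1] := h5 x y; split; exact: fin.
  move=> T t TH.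
  have [T' [t' [TH' t'P]]] := lbf_test t HG a0 TH.
  have [w [ws wt]] := spt T' t' TH'.
  have wB x : content (w x) = B by rewrite -contE ws sB.
  have wn x : w x <> [::] by move=> wx; apply: Bn; rewrite -(wB x) wx content_nil.
  have /choice[f fE] x : exists f, lbf finset.set0 (w x) = Some f.
    case e : (lbf _ _) => [f|]; first by exists f.
    by case: Bn; apply/eqP; rewrite -finset.subset0 -(wB x); exact: lbf_none_content.
  have fS x : [/\ w x = (f x).1.1 ++ (f x).1.2 :: (f x).2, (f x).1.2 \notin content (f x).1.1 &
      content (w x) \subset ((f x).1.2 |: content (f x).1.1)%SET].
    have := fE x; case: (f x) => [[w0 a] w1] /= /lbf_some[-> _ aw0].
    by rewrite finset.set0U.
  have fT x y : [/\ ev t (f x).1.1 = ev t (f y).1.1, (f x).1.2 = (f y).1.2,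
      ev t (f x).2 = ev t (f y).2 & content (f x).2 = content (f y).2].
    have := lbf_dataP finset.set0 (t'P _ _ (wt x y) (wn x)).
    by rewrite !fE; case: (f x) => [[? ?] ?]; case: (f y) => [[? ?] ?].
  have fa x : (f x).1.2 = (f x0).1.2 by have [] := fT x x0.
  exists ((f x0).1.2, [ffun x => ev phi (f x).1.1], [ffun x => ev phi (f x).2]).
  exists (fun x => (f x).1.1), (fun x => (f x).2); split=> /=.
  - split=> [|x|x]; rewrite ?ffunE //.
    by rewrite -(wB x0); have [-> _ _] := fS x0; rewrite in_content mem_cat inE eqxx orbT.
  - by move=> x; rewrite -ws -(fa x); have [<-] := fS x.
  - move=> x; rewrite -(fa x) -(wB x); have [e na sub] := fS x; split; last first.
      rewrite e content_cat content_cons; apply/fintype.subsetP => b bw.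
      by rewrite finset.in_setU finset.in_setU1 bw !orbT.
    apply/finset.setP => b; rewrite finset.in_setD1.
    apply/idP/andP => [bw|[ba bw]].
      split; first by apply: contraNneq na => <-.
      by rewrite e content_cat finset.in_setU bw.
    by have := fintype.subsetP sub b bw; rewrite finset.in_setU1 (negbTE ba).
  - by move=> x y; have [] := fT x y.
  - by move=> x y; have [] := fT x y.
have TH := DRH_trivial HG.
have [w0 [w1 [/= [aB w0s w1s] sE w01 w1c _]]] := qR _ (fun=> ord0) TH.
exists a, s0, s1; split=> //.
- by move=> x; rewrite sE ev_cat /= mulgA w0s w1s.
- split=> T' t TH'; have [z0 [z1 [/= [_ z0s z1s] _ _ _ zT]]] := qR T' t TH'.
    by exists z0; split=> // x y; have [] := zT x y.
  by exists z1; split=> // x y; have [] := zT x y.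
- by move=> x; rewrite -w0s contE; have [] := w01 x.
exists (content (w1 x0)); first by have [] := w01 x0.
by move=> x; rewrite -w1s contE.
Qed.

(** In the relation [E], a tuple is obtained from another one by multiplication
    on the left by a realized tuple of full content.  By [pointlike_step], an
    unrealized pointlike tuple is related to another one, which gives a
    cycle. *)
Lemma pointlike_realized (s : X -> P^I) (B : {set A}) :
  pointlike phi (DRH H) s -> (forall x, cont (s x) = B) -> realized s.
Proof.
have words (s' : X -> P^I) : pointlike phi (DRH H) s' -> exists w, forall x, ev phi (w x) = s' x.
  by move=> /(_ _ (fun=> ord0) (DRH_trivial HG)) [w [wE _]]; exists w.
have [k Bk] : exists k, (#|B| < k)%N by exists #|B|.+1.
elim: k B Bk s => // k IH B Bk s spt sB; have [B0|Bn] := pselect (B = finset.set0).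
  have [w wE] := words s spt.
  exists (fun=> None); split=> // x; rewrite -wE.
  suff -> : w x = [::] by [].
  have : content (w x) = finset.set0 by rewrite -contE wE sB.
  by case: (w x) => // a z /finset.setP/(_ a); rewrite in_content in_cons eqxx finset.in_set0.
apply: contrapT => ns.
pose D (z : {ffun X -> option P}) :=
  [/\ pointlike phi (DRH H) z, forall x, cont (z x) = B & ~ realized z].
pose E (z z' : {ffun X -> option P}) := exists q : X -> P^I,
  [/\ realized q, forall x, cont (q x) = B & forall x, z x = q x * (z' x : P^I)].
have Etrans x y z : E x y -> E y z -> E x z.
  move=> [q [qr qB xE]] [q' [qr' qB' yE]]; exists (fun i => q i * q' i); split.
  - exact: realized_mul.
  - move=> i; have [v [_ vphi _]] := qr; have [v' [_ vphi' _]] := qr'.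
    have [w [_ wE]] := valI_dense2 phi phi (v i).
    have [w' [_ wE']] := valI_dense2 phi phi (v' i).
    rewrite -vphi -vphi' -wE -wE' -ev_cat contE content_cat -!contE wE wE' vphi vphi'.
    by rewrite qB qB' finset.setUid.
  - by move=> i; rewrite xE yE mulgA.
have step z : D z -> exists z', D z' /\ E z z'.
  move=> [zpt zB nz].
  have [a [s0 [s1 [aB zE [pt0 pt1] s0B [B1 B1B s1B]]]]] := pointlike_step Bn zpt zB.
  have r0 : realized s0.
    apply: (IH (B :\ a)%SET) => //.
    by move: Bk; rewrite (finset.cardsD1 a) aB.
  have rq := realized_mul r0 (realized_letter a).
  have r1 : ~ realized s1.
    move=> r1; apply: nz; have [v [vs vphi vT]] := realized_mul rq r1.
    by exists v; split=> // x; rewrite vphi -zE.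
  have B1E : B1 = B.
    apply/eqP; rewrite finset.eqEcard B1B leqNgt; apply/negP => B1lt.
    by apply/r1/(IH B1) => //; exact: leq_trans B1lt _.
  have s1E : ([ffun x => s1 x] : {ffun X -> option P}) = s1 :> (X -> P^I).
    by apply/funext => x; rewrite ffunE.
  exists [ffun x => s1 x]; split; first by split; rewrite ?s1E // -B1E.
  exists (fun x => s0 x * (Some (phi a) : P^I)); split=> //.
    move=> x; have [w wE] := words s0 pt0.
    rewrite -wE -[Some (phi a)]/(ev phi [:: a]) -ev_cat contE content_cat -contE wE s0B.
    rewrite content_cons content_nil finset.setU0 finset.setUC.
    exact: finset.setD1K.
  by move=> x; rewrite ffunE zE.
have sE : ([ffun x => s x] : {ffun X -> option P}) = s :> (X -> P^I).
  by apply/funext => x; rewrite ffunE.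
have [|z [[zpt zB nz] [q [qr qB zE]]]] := finite_cycle Etrans step (x := [ffun x => s x]).
  by split; rewrite ?sE.
by apply: nz; exact: (realized_absorb Bn qr qB zpt zB zE).
Qed.

End Realization.

(** * Systems of pointlike equations modulo DRH *)

Section ContentTable.
Variables (A : finType) (S : finSemigroup) (s : A -> S).

Fact content_table_mulA : associative (fun U W : {set A} => (U :|: W)%SET).
Proof. exact: finset.setUA. Qed.

Definition content_table := table content_table_mulA finset.set0.

Definition content_enc (U : {set A}) : content_table := table_enc (finset.set0 : {set A}) U.
Definition content_dec (x : content_table) : {set A} := table_dec (finset.set0 : {set A}) x.

(** Pairing with the union semilattice of sets of letters makes any test detect
    contents. *)
Lemma content_test : exists (P : finSemigroup) (phi : A -> P) (cont : P^I -> {set A}),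
  finer phi s /\ forall w, cont (ev phi w) = content w.
Proof.
pose c a := content_enc [set a]%SET.
have [fs fc] := finer_prod s c.
exists (prod_table S content_table), (fun a => prod_enc (s a, c a)).
exists (fun p => oapp (fun x => content_dec (prod_dec x).2) finset.set0 p); split=> // w.
elim: w => [|a w IH]; first by rewrite content_nil.
rewrite content_cons -IH /=; case: (ev _ w) => [x|].
  by rewrite someM /= prod_mulE prod_encK /= [content_dec _]table_decM [table_dec _ _]table_encK.
by rewrite mulg1 /= prod_encK /= finset.setU0; exact: table_encK.
Qed.
End ContentTable.

Section EqDRH.
Variables (H : set finSemigroup) (HG : pseudovariety_of_groups H) (A : finType).

Lemma eq_mod_DRH (u v : (pseudoword A)^I) :
  eq_mod (DRH H) u v <-> forall (T : finSemigroup) (t : A -> T), DRH H T -> valI t u = valI t v.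
Proof.
have T0H := DRH_trivial HG.
case: u v => [u|] [v|] //.
- rewrite eq_mod_some; split=> uv T t TH; first by rewrite /= uv.
  by have [] := uv T t TH.
- rewrite /eq_mod /=; case: pselect => [/(DRH_nongroup HG)//|_]; split=> // uv.
  by have := uv _ (fun=> ord0) T0H.
- rewrite /eq_mod /=; case: pselect => [/(DRH_nongroup HG)//|_]; split=> // uv.
  by have := uv _ (fun=> ord0) T0H.
Qed.

(** Contents agree because the quotients of [lbf_test] detect them and belong to
    DRH. *)
Lemma eq_mod_pointlike (X : finType) (u : X -> (pseudoword A)^I) (P : finSemigroup) (phi : A -> P)
    (cont : P^I -> {set A}) :
  (forall w, cont (ev phi w) = content w) ->
  (forall x y, eq_mod (DRH H) (u x) (u y)) ->
  pointlike phi (DRH H) (fun x => valI phi (u x)) /\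
  forall x y, cont (valI phi (u x)) = cont (valI phi (u y)).
Proof.
move=> contE uE.
have uT (T : finSemigroup) (t : A -> T) : DRH H T -> forall x y, valI t (u x) = valI t (u y).
  by move=> TH x y; exact: (eq_mod_DRH _ _).1 (uE x y) _ _ TH.
split=> [T t TH|x y].
  have /choice[w wE] x := valI_dense2 phi t (u x).
  exists w; split=> x; first by have [] := wE x.
  by move=> y; have [_ ->] := wE x; have [_ ->] := wE y; exact: uT.
have T0H := DRH_trivial HG.
have cont0 z : u z = None -> cont (valI phi (u z)) = finset.set0.
  by move=> ->; rewrite (contE [::]) content_nil.
have [ux|un] := pselect (u x = None).
  have uy : u y = None.
    by apply: (valI_none (t := fun=> ord0 : trivial_table)); rewrite (uT _ _ T0H _ x) ux.
  by rewrite !cont0.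
have [a0 _] : exists a : A, True by case: (u x) un => // v _; exact: pseudoword_letter v.
have [T' [t' [TH' t'P]]] := lbf_test (fun=> ord0) HG a0 T0H.
have [w [wphi wt]] := valI_dense2 phi t' (u x).
have [z [zphi zt]] := valI_dense2 phi t' (u y).
have wz : ev t' w = ev t' z by rewrite wt zt; exact: uT.
have wn : w <> [::] by move=> w0; apply: un; apply: (valI_none (t := t')); rewrite -wt w0.
by rewrite -wphi -zphi !contE; have [_ -> _] := t'P _ _ wz wn.
Qed.
End EqDRH.

Lemma open_testI (A : finType) (K : set ((pseudoword A)^I)) (v : (pseudoword A)^I) :
  open K -> K v -> exists (T : finSemigroup) (t : A -> T), forall u, valI t u = valI t v -> K u.
Proof.
move=> oK; case: v => [v|] Kv.
  have [T [t tK]] := open_test (oK : open [set x | K (Some x)]) Kv.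
  by exists T, t => -[u|] //= [] /tK.
by exists trivial_table, (fun=> ord0) => u /valI_none ->.
Qed.

Lemma finer_valI (A : finType) (S T : finSemigroup) (s : A -> S) (t : A -> T)
    (u v : (pseudoword A)^I) : finer s t -> valI s u = valI s v -> valI t u = valI t v.
Proof.
move=> st uv; have [w [ws <-]] := valI_dense2 s t u; have [z [zs <-]] := valI_dense2 s t v.
by apply: st; rewrite ws zs.
Qed.

Theorem theorem3p1 (sigma : op_set) (H : set finSemigroup)
  (sigma_sig : implicit_signature sigma)
  (sigma_hc : highly_computable sigma)
  (sigma_nonexplicit :
     exists (n : nat) (p : pseudoword 'I_n), sigma n p /\ ~ explicit_op p)
  (H_groups : pseudovariety_of_groups H)
  (H_re : rec_enumerable_class H)
  (H_reducible : reducible sigma H pointlike_systems) :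
  reducible sigma (DRH H) pointlike_systems.
Proof.
move=> X A E K [B _ EB] Kclopen [delta [_ deltaE deltaK]].
have /choice[tau tauP] x : exists Tt : {T : finSemigroup & A -> T},
    forall u, valI (tagged Tt) u = valI (tagged Tt) (delta (gen x)) -> K x u.
  have [T [t tK]] := open_testI (Kclopen x).1 (deltaK x).
  by exists (existT _ T t).
have [S [s [_ sP]]] : exists (S : finSemigroup) (s : A -> S),
    pvS S /\ forall x, finer s (tagged (tau x)).
  by apply: common_refinement => //; exists trivial_table.
have [P [phi [cont [phis contE]]]] := content_test s.
pose r x := rhoI (DRH H) (delta (gen x)).
have classP (c : (free_pro (DRH H) A)^I) : exists v : X -> (pseudoword A)^I, forall x, r x = c ->
    [/\ sigma_wordI sigma (v x), valI phi (v x) = valI phi (delta (gen x)) &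
        forall y, r y = c -> eq_mod (DRH H) (v x) (v y)].
  have [[x0 rx0]|nc] := pselect (exists x0, r x0 = c); last first.
    by exists (fun=> None) => x rx; case: nc; exists x.
  (* Variables outside the class are given the value of a member [x0] of it. *)
  pose u x := if pselect (r x = c) then delta (gen x) else delta (gen x0).
  have uE x : rhoI (DRH H) (u x) = c by rewrite /u; case: pselect.
  have [upt ucont] := eq_mod_pointlike H_groups contE (u := u)
    (fun x y => etrans (uE x) (esym (uE y))).
  have [v [vs vphi vT]] := pointlike_realized sigma_sig sigma_nonexplicit H_groups H_reducible
    x0 contE upt (B := cont (valI phi (u x0))) (fun x => ucont x x0).
  exists v => x rx; split=> //; first by rewrite vphi /u; case: pselect.
  by move=> y _; apply/(eq_mod_DRH H_groups) => T t TH; exact: vT.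
have /choice[v vP] := classP.
have [d [dc dE]] := extension (fun x => v (r x) x).
exists d; last by move=> x; rewrite dE; have [] := vP _ x erefl.
split=> // [e|x].
  rewrite -EB => /flatten_mapP[b bB /mapP[[x y] xy ->]] /=.
  have rxy : r x = r y.
    apply: (deltaE (gen x, gen y)); rewrite -EB; apply/flatten_mapP; exists b => //.
    by apply/mapP; exists (x, y).
  by rewrite !dE rxy; have [_ _] := vP (r y) x rxy; apply.
rewrite dE; apply: tauP; have [_ vphi _] := vP _ x erefl.
by apply: finer_valI vphi; apply: finer_trans phis _; exact: sP.
Qed.
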